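(* Let $A$ be a supercommutative superalgebra over a field of characteristic $0$, let $V=A^{p|q}$ be a free $A$-supermodule of rank $p|q$, and let $R=\mathrm{Sym}_A^\bullet V$. Let $(\mathcal{K}^\ast_\bullet,\delta^\ast)$ be the dual of the super Koszul complex of $V$, and $\mathrm{Ext}^i_R(A,R)=H^i((\mathcal{K}^\ast_\bullet,\delta^\ast))$ its homology at $\mathcal{K}^\ast_i$. Then, as $A$-supermodules, $$\mathrm{Ext}^i_R(A,R)\cong\begin{cases}\Pi^{p+q}A & i=p,\\ 0 & \text{otherwise}.\end{cases}$$ In particular, a generator of $\mathrm{Ext}^p_R(A,R)$ is given by the class of the element $\theta_1\cdots\theta_q\otimes\partial_{\chi_1}\cdots\partial_{\chi_p}\in\mathcal{K}^\ast_p$.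
   Context: $V$ has $A$-basis $\{x_1,\dots,x_p\,|\,\theta_1,\dots,\theta_q\}$ with $x_i$ even and $\theta_j$ odd. $\Pi$ is the parity-changing functor; $\Pi V$ has basis $\{\ell_1,\dots,\ell_q\,|\,\chi_1,\dots,\chi_p\}$ with $\ell_j=\pi\theta_j$ even and $\chi_i=\pi x_i$ odd. The dual module $\Pi V^\ast:=(\Pi V)^\ast=\mathrm{Hom}_A(\Pi V,A)$ has dual basis denoted $\{\partial_{\ell_1},\dots,\partial_{\ell_q}\,|\,\partial_{\chi_1},\dots,\partial_{\chi_p}\}$, with $\partial_{\ell_j}$ even and $\partial_{\chi_i}$ odd. $\mathrm{Sym}^k$ is the supersymmetric power over $A$. The super Koszul complex of $V$ is $\mathcal{K}_\bullet=\bigoplus_{k\ge 0}R\otimes_A\mathrm{Sym}^k\Pi V$ with differential the odd superderivation $\delta=\sum_i x_i\otimes\partial_{\chi_i}+\sum_j\theta_j\otimes\partial_{\ell_j}$ (so $\delta(\chi_i)=x_i$, $\delta(\ell_j)=\theta_j$, $\delta|_R=0$); it is a resolution of the $R$-module $A=R/\bigoplus_{k\ge1}\mathrm{Sym}^kV$ by free $R$-modules. Its dual, obtained by applying $\mathrm{Hom}_R(-,R)$ termwise, is $$\mathcal{K}^\ast_\bullet=\bigoplus_{k\ge0}\mathcal{K}^\ast_k,\qquad \mathcal{K}^\ast_k=R\otimes_A\mathrm{Sym}^k\Pi V^\ast,$$ with differential $\delta^\ast:\mathcal{K}^\ast_k\to\mathcal{K}^\ast_{k+1}$ given by multiplication by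 the odd element $\sum_{i=1}^p x_i\otimes\partial_{\chi_i}+\sum_{j=1}^q\theta_j\otimes\partial_{\ell_j}$ in the supercommutative algebra $R\otimes_A\mathrm{Sym}^\bullet\Pi V^\ast$. By definition $\mathrm{Ext}^i_R(A,R):=H^i(\mathrm{Hom}_R(\mathcal{K}_\bullet,R))=H^i((\mathcal{K}^\ast_\bullet,\delta^\ast))$. *)

(* Defs.v *)
Set Warnings "-notation-overridden,-ambiguous-paths,-notation-incompatible-prefix".
From HB Require Import structures.
From mathcomp Require Import all_boot all_order all_algebra.
From mathcomp Require Import boolp functions.

Set Implicit Arguments.
Unset Strict Implicit.
Unset Printing Implicit Defensive.

Import GRing.Theory.
Local Open Scope ring_scope.
Local Open Scope quotient_scope.

(* Everything is Z/2-graded; parities are booleans, false = even, true = odd,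
   and (+) on bool is addition of parities.  A grading V = V_0 (+) V_1 is given
   by its two projectors, part b : V -> V_b. *)

HB.mixin Record isSuper V of GRing.Zmodule V := {
  part : bool -> V -> V;
  partD : forall b, {morph part b : x y / x + y};
  part_part : forall b c x, part b (part c x) = if b == c then part c x else 0;
  part_sum : forall x, part false x + part true x = x
}.

#[short(type="superZmodType")]
HB.structure Definition SuperZmodule := {V of isSuper V & GRing.Zmodule V}.

Definition homog (V : superZmodType) (b : bool) (x : V) : bool := part b x == x.

(* x |-> (-1)^|x| x *)
Definition bar (V : superZmodType) (x : V) : V := part false x - part true x.

Section SuperZmoduleTheory.
Variable V : superZmodType.
Implicit Types (x y : V) (b c : bool).

Lemma part0 b : part b (0 : V) = 0.
Proof. by apply: (addrI (part b 0)); rewrite -partD !addr0. Qed.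

Lemma partN b x : part b (- x) = - part b x.
Proof. by apply/eqP; rewrite -addr_eq0 -partD addNr part0. Qed.

Lemma partB b x y : part b (x - y) = part b x - part b y.
Proof. by rewrite partD partN. Qed.

Lemma homogP b x : reflect (part b x = x) (homog b x).
Proof. exact: eqP. Qed.

Lemma homog_part b x : homog b (part b x).
Proof. by apply/homogP; rewrite part_part eqxx. Qed.

Lemma part_homog b c x : homog c x -> part b x = if b == c then x else 0.
Proof. by move/homogP=> <-; rewrite part_part. Qed.

Lemma homog0 b : homog b (0 : V).
Proof. by apply/homogP; rewrite part0. Qed.

Lemma homogD b x y : homog b x -> homog b y -> homog b (x + y).
Proof. by move=> /homogP hx /homogP hy; apply/homogP; rewrite partD hx hy. Qed.

Lemma homogN b x : homog b x -> homog b (- x).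
Proof. by move=> /homogP hx; apply/homogP; rewrite partN hx. Qed.

Lemma homog_sum b I (r : seq I) (P : pred I) (F : I -> V) :
  (forall i, P i -> homog b (F i)) -> homog b (\sum_(i <- r | P i) F i).
Proof.
move=> hF; elim/big_rec: _ => [|i x Pi hx]; first exact: homog0.
by apply: homogD => //; exact: hF.
Qed.

(* the components of a sum of homogeneous elements of both parities *)
Lemma part_homogD b x y :
  homog b x -> homog (~~ b) y -> (part b (x + y) = x) * (part (~~ b) (x + y) = y).
Proof.
move=> hx hy; rewrite !partD !(part_homog _ hx) !(part_homog _ hy) !eqxx.
by case: b {hx hy}; rewrite /= ?addr0 ?add0r.
Qed.

Lemma barD x y : bar (x + y) = bar x + bar y.
Proof. by rewrite /bar !partD opprD addrACA. Qed.

Lemma bar0 : bar (0 : V) = 0.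
Proof. by rewrite /bar !part0 subr0. Qed.

Lemma bar_homog b x : homog b x -> bar x = if b then - x else x.
Proof.
move=> hx; rewrite /bar !(part_homog _ hx).
by case: b {hx}; rewrite /= ?sub0r ?subr0.
Qed.

Lemma barK x : bar (bar x) = x.
Proof. by rewrite /bar !partB !part_part /= !subr0 sub0r opprK part_sum. Qed.

Lemma part_bar b x : part b (bar x) = if b then - part b x else part b x.
Proof. by rewrite /bar partB !part_part; case: b; rewrite /= ?sub0r ?subr0. Qed.

(* additive statements can be checked on homogeneous elements *)
Lemma super_ind (P : V -> Prop) :
  (forall x y, P x -> P y -> P (x + y)) ->
  (forall b x, homog b x -> P x) -> forall x, P x.
Proof.
by move=> PD Ph x; rewrite -(part_sum x); apply: PD; exact/Ph/homog_part.
Qed.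

End SuperZmoduleTheory.

HB.mixin Record isSuperRing R of SuperZmodule R & GRing.PzRing R := {
  homog1 : homog false (1 : R);
  homogM : forall b c (x y : R),
    homog b x -> homog c y -> homog (b (+) c) (x * y)
}.

#[short(type="superRingType")]
HB.structure Definition SuperRing :=
  {R of isSuperRing R & SuperZmodule R & GRing.PzRing R}.

HB.mixin Record isSuperCom R of SuperRing R := {
  supermulC : forall b c (x y : R),
    homog b x -> homog c y -> x * y = (-1) ^+ (b && c) * (y * x)
}.

#[short(type="superComRingType")]
HB.structure Definition SuperComRing := {R of isSuperCom R & SuperRing R}.

HB.mixin Record isSuperLmodule (A : superRingType) M
    of SuperZmodule M & GRing.Lmodule A M := {
  homogZ : forall b c (a : A) (m : M),
    homog b a -> homog c m -> homog (b (+) c) (a *: m)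
}.

#[short(type="superLmodType")]
HB.structure Definition SuperLmodule (A : superRingType) :=
  {M of isSuperLmodule A M & SuperZmodule M & GRing.Lmodule A M}.

(* Multiplication and scaling on homogeneous components. *)

Section SuperLmoduleTheory.
Variables (A : superRingType) (M : superLmodType A).

Lemma partZ b (a : A) (m : M) :
  part b (a *: m) = part false a *: part b m + part true a *: part (~~ b) m.
Proof.
have h c d : homog (c (+) d) (part c a *: part d m).
  by apply: homogZ; exact: homog_part.
rewrite -{1}(part_sum a) -{1}(part_sum m) scalerDl !scalerDr !partD.
rewrite !(part_homog _ (h _ _)).
by case: b; rewrite /= ?add0r ?addr0.
Qed.

Lemma partZ_even b c (a : A) (m : M) :
  homog c a -> part b (a *: m) = a *: part (b (+) c) m.
Proof.
move=> ha; rewrite partZ !(part_homog _ ha).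
by case: c {ha}; rewrite /= !scale0r ?addr0 ?add0r ?addbT ?addbF.
Qed.

Lemma barZ (a : A) (m : M) : bar (a *: m) = bar a *: bar m.
Proof.
rewrite {1 3}/bar !partZ /= {1}/bar scalerBl !scalerBr !opprD !opprK.
by rewrite addrACA -!addrA; congr (_ + _); rewrite [- _ + _]addrC addrCA.
Qed.

End SuperLmoduleTheory.

Section Regular.
Variable A : superRingType.

HB.instance Definition _ := SuperZmodule.on A^o.

Fact regular_homogZ b c (a : A) (m : A^o) :
  homog b a -> homog c m -> homog (b (+) c) (a *: m).
Proof. exact: homogM. Qed.

HB.instance Definition _ := isSuperLmodule.Build A A^o regular_homogZ.

End Regular.

Section SuperRingTheory.
Variable R : superRingType.

Lemma partM b (x y : R) :
  part b (x * y) = part false x * part b y + part true x * part (~~ b) y.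
Proof. exact: (@partZ R R^o). Qed.

Lemma barM (x y : R) : bar (x * y) = bar x * bar y.
Proof. exact: (@barZ R R^o). Qed.

End SuperRingTheory.

Lemma supermulE (R : superComRingType) (x y : R) :
  x * y = part false y * x + part true y * bar x.
Proof.
elim/super_ind: x => [x x' IH IH'|b x hx].
  by rewrite mulrDl IH IH' barD !mulrDr addrACA.
rewrite -{1}(part_sum y) mulrDr !(supermulC _ _ _ _ hx (homog_part _ _)) (bar_homog hx).
by case: b {hx}; rewrite /= ?expr1 ?mulN1r ?mulrN !mul1r.
Qed.

(* The right action m a = (-1)^(|a| |m|) a m of A on a left supermodule. *)
Definition rscale (A : superRingType) (M : superLmodType A) (m : M) (a : A) : M :=
  part false a *: m + part true a *: bar m.

Section RightAction.
Variables (A : superComRingType) (M : superLmodType A).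

Lemma rscaleDl (m n : M) (a : A) : rscale (m + n) a = rscale m a + rscale n a.
Proof. by rewrite /rscale barD !scalerDr addrACA. Qed.

Lemma rscaleZ (b : A) (m : M) (a : A) : rscale (b *: m) a = b *: rscale m a.
Proof.
rewrite /rscale barZ [RHS]scalerDr !scalerA; congr (_ *: _ + _ *: _).
  by rewrite [RHS]supermulE !part_part /= mul0r addr0.
by rewrite [RHS]supermulE !part_part /= mul0r add0r.
Qed.

End RightAction.

(* The standard free module A^(p|q), with even basis x_i = svec (inl i) and odd
   basis theta_j = svec (inr j). *)
Definition sfree (A : superRingType) (p q : nat) : Type := {ffun 'I_p + 'I_q -> A^o}.

Definition is_odd_index p q (s : 'I_p + 'I_q) : bool := if s is inr _ then true else false.

Section Free.
Variables (A : superRingType) (p q : nat).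

HB.instance Definition _ := GRing.Lmodule.on (sfree A p q).

Definition fpart (b : bool) (v : sfree A p q) : sfree A p q :=
  [ffun s => part (b (+) is_odd_index s) (v s)].

Fact fpartD b : {morph fpart b : x y / x + y}.
Proof. by move=> x y; apply/ffunP=> s; rewrite !ffunE partD. Qed.

Fact fpart_part b c x : fpart b (fpart c x) = if b == c then fpart c x else 0.
Proof.
apply/ffunP=> s; rewrite !ffunE part_part.
by case: b; case: c; rewrite /= !ffunE; case: (is_odd_index s).
Qed.

Fact fpart_sum x : fpart false x + fpart true x = x.
Proof.
apply/ffunP=> s; rewrite !ffunE; case: (is_odd_index s); rewrite /= ?part_sum //.
by rewrite addrC part_sum.
Qed.

HB.instance Definition _ :=
  isSuper.Build (sfree A p q) fpartD fpart_part fpart_sum.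

Fact fhomogZ b c (a : A) (m : sfree A p q) :
  homog b a -> homog c m -> homog (b (+) c) (a *: m).
Proof.
move=> ha /homogP hm; apply/homogP/ffunP=> s; rewrite !ffunE.
rewrite (partZ_even _ _ ha) -[in RHS]hm !ffunE; congr (_ *: part _ _).
by case: b c (is_odd_index s) {ha hm} => [] [] [].
Qed.

HB.instance Definition _ := isSuperLmodule.Build A (sfree A p q) fhomogZ.

Definition svec (s : 'I_p + 'I_q) : sfree A p q := [ffun t => (t == s)%:R].

End Free.

(* The parity change: Pi M has the elements of M, the opposite grading, and the
   action a . (pi m) = (-1)^|a| pi (a m). *)
Definition Pi (A : superRingType) (M : superLmodType A) : Type := M.

Section ParityChange.
Variables (A : superRingType) (M : superLmodType A).

HB.instance Definition _ := GRing.Zmodule.on (Pi M).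

Definition to_Pi (m : M) : Pi M := m.
Definition of_Pi (m : Pi M) : M := m.
Definition pipart (b : bool) (m : Pi M) : Pi M := to_Pi (part (~~ b) (of_Pi m)).

Fact pipartD b : {morph pipart b : x y / x + y}.
Proof. by move=> x y; rewrite /pipart /of_Pi /to_Pi (@partD M). Qed.

Fact pipart_part b c x : pipart b (pipart c x) = if b == c then pipart c x else 0.
Proof. by rewrite /pipart /of_Pi /to_Pi part_part; case: b; case: c. Qed.

Fact pipart_sum x : pipart false x + pipart true x = x.
Proof. by rewrite /pipart addrC part_sum. Qed.

HB.instance Definition _ := isSuper.Build (Pi M) pipartD pipart_part pipart_sum.

Definition piscale (a : A) (m : Pi M) : Pi M := to_Pi (bar a *: of_Pi m).

Fact piscaleA a b v : piscale a (piscale b v) = piscale (a * b) v.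
Proof. by rewrite /piscale /to_Pi /of_Pi scalerA barM. Qed.

Fact piscale1 : left_id 1 piscale.
Proof. by move=> v; rewrite /piscale (bar_homog homog1) scale1r. Qed.

Fact piscaleDr : right_distributive piscale +%R.
Proof. by move=> a u v; rewrite /piscale scalerDr. Qed.

Fact piscaleDl v : {morph piscale^~ v : a b / a + b}.
Proof. by move=> a b; rewrite /piscale barD scalerDl. Qed.

HB.instance Definition _ :=
  GRing.Zmodule_isLmodule.Build A (Pi M) piscaleA piscale1 piscaleDr piscaleDl.

Fact pihomogZ b c (a : A) (m : Pi M) :
  homog b a -> homog c m -> homog (b (+) c) (a *: m).
Proof.
move=> ha hm; have hm2 : @homog M (~~ c) m.
  by apply/eqP; move/eqP: hm; exact.
suff /eqP h : @homog M (b (+) ~~ c) (bar a *: (m : M)).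
  by apply/eqP; rewrite addbN in h; exact: h.
apply: homogZ; last exact: hm2.
by rewrite (bar_homog ha); case: b ha => // ha; exact: homogN.
Qed.

HB.instance Definition _ := isSuperLmodule.Build A (Pi M) pihomogZ.

End ParityChange.

Definition iterPi (A : superRingType) (n : nat) (M : superLmodType A) : superLmodType A :=
  iter n (fun N : superLmodType A => Pi N : superLmodType A) M.

(* The dual Hom_A(M, A): maps linear for the right actions, with left action
   (a f)(m) = a f(m); f is homogeneous of parity b when it shifts parities by b. *)
Definition rlinear (A : superRingType) (M : superLmodType A) (f : M -> A^o) : Prop :=
  (forall m n, f (m + n) = f m + f n) /\
  (forall m a, f (rscale m a) = (f m : A) * a).

Section Dual.
Variables (A : superRingType) (M : superLmodType A).

Definition rlin_pred : pred (M -> A^o) := fun f => `[< rlinear f >].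

Record dual : Type := Dual { dual_fun :> M -> A^o; _ : rlin_pred dual_fun }.

Fact rlin_submod : subsemimod_closed rlin_pred.
Proof.
split; first split.
- apply/asboolP; split=> [m n|m a]; first by rewrite addr0.
  by rewrite mul0r.
- move=> f g /asboolP[fD fZ] /asboolP[gD gZ]; apply/asboolP; split=> [m n|m b].
    by rewrite !fctE fD gD addrACA.
  by rewrite !fctE fZ gZ -mulrDl.
- move=> a f /asboolP[fD fZ]; apply/asboolP; split=> [m n|m b].
    by rewrite !fctE fD scalerDr.
  by rewrite !fctE fZ -mulrA.
Qed.

HB.instance Definition _ := GRing.isSubSemiModClosed.Build A (M -> A^o) rlin_pred
  rlin_submod.
HB.instance Definition _ := [isSub for dual_fun].
HB.instance Definition _ := [Choice of dual by <:].
HB.instance Definition _ := [SubChoice_isSubLmodule of dual by <:].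

Lemma dualP (f g : dual) : (forall m, f m = g m) -> f = g.
Proof. by move=> fg; apply/val_inj/funext. Qed.

Lemma dual_rlinear (f : dual) : rlinear f.
Proof. by case: f => f /= /asboolP. Qed.

Definition dpart (b : bool) (f : dual) : M -> A^o := fun m =>
  part b (f (part false m)) + part (~~ b) (f (part true m)).

Fact part_mulr b c (x a : A) : part b (x * part c a) = part (b (+) c) x * part c a.
Proof.
by rewrite partM !part_part; case: b; case: c; rewrite /= !mulr0 ?addr0 ?add0r.
Qed.

Lemma part_rscale c (m : M) (a : A) :
  part c (rscale m a) = rscale (part c m) (part false a) +
                        rscale (part (~~ c) m) (part true a).
Proof.
rewrite /rscale partD !(partZ_even _ _ (homog_part _ _)) addbF addbT.
rewrite !part_part /= !scale0r addr0 add0r; congr (_ + _ *: _).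
by rewrite part_bar (bar_homog (homog_part _ _)); case: c.
Qed.

Fact dpart_subproof b (f : dual) : rlin_pred (dpart b f).
Proof.
have [fD fZ] := dual_rlinear f; apply/asboolP; split=> [m n|m a].
  by rewrite /dpart !partD !fD !partD addrACA.
have e x y u v : f (rscale x u + rscale y v) = (f x : A) * u + (f y : A) * v.
  by rewrite fD !fZ.
rewrite /dpart !part_rscale !e !(@partD A) !part_mulr !addbF !addbT negbK.
by rewrite -[in RHS](part_sum a) /= mulrDr !mulrDl addrACA; congr (_ + _); rewrite addrC.
Qed.

Definition dual_part b (f : dual) : dual := Dual (dpart_subproof b f).

Fact dual_partD b : {morph dual_part b : f g / f + g}.
Proof. by move=> f g; apply: dualP => m; rewrite /= /dpart !partD addrACA. Qed.

Lemma dual_fun0 (f : dual) : f 0 = 0.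
Proof. by apply: (addrI (f 0)); rewrite -(dual_rlinear f).1 !addr0. Qed.

Fact dual_part_part b c f :
  dual_part b (dual_part c f) = if b == c then dual_part c f else 0.
Proof.
apply: dualP => m; case: b; case: c; rewrite /= /dpart /= /dpart;
  by rewrite !(@part_part M) /= !dual_fun0 !(@partD A) !(@part_part A) /=
             ?(@part0 A) ?addr0 ?add0r.
Qed.

Fact dual_part_sum f : dual_part false f + dual_part true f = f.
Proof.
apply: dualP => m; rewrite /= !fctE /dpart /= addrACA part_sum.
by rewrite [X in _ + X]addrC part_sum -(dual_rlinear f).1 part_sum.
Qed.

HB.instance Definition _ :=
  isSuper.Build dual dual_partD dual_part_part dual_part_sum.

Fact dual_homogZ b c (a : A) (f : dual) :
  homog b a -> homog c f -> homog (b (+) c) (a *: f).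
Proof.
move=> ha /homogP hf; apply/homogP/dualP=> m.
rewrite -[in RHS]hf /= !fctE /dpart /= !(@partZ_even A A^o _ _ _ _ ha) scalerDr.
by congr (_ *: part _ _ + _ *: part _ _); case: b c {ha hf} => [] [].
Qed.

HB.instance Definition _ := isSuperLmodule.Build A dual dual_homogZ.

End Dual.

Inductive sums_of (V : nmodType) (S : V -> Prop) : V -> Prop :=
| sums_of0 : sums_of S 0
| sums_of_cons x y : S x -> sums_of S y -> sums_of S (x + y).

Section SumsOf.
Variables (V : nmodType) (S : V -> Prop).

Lemma sums_of1 x : S x -> sums_of S x.
Proof. by move=> hx; rewrite -[x]addr0; apply: sums_of_cons => //; exact: sums_of0. Qed.

Lemma sums_ofD x y : sums_of S x -> sums_of S y -> sums_of S (x + y).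
Proof.
by elim=> [|u v hu _ IH] hy; rewrite ?add0r // -addrA; apply: sums_of_cons => //; exact: IH.
Qed.

End SumsOf.

Lemma sums_of_map (V W : nmodType) (S : V -> Prop) (T : W -> Prop) (f : V -> W) :
  f 0 = 0 -> {morph f : x y / x + y} -> (forall x, S x -> sums_of T (f x)) ->
  forall x, sums_of S x -> sums_of T (f x).
Proof.
move=> f0 fD fS x; elim=> [|u v hu _ IH]; first by rewrite f0; exact: sums_of0.
by rewrite fD; apply: sums_ofD => //; exact: fS.
Qed.

(* The supersymmetric algebra Sym_A M: the ring generated by A and M, in which A
   is a subring image, M an A-module image, and homogeneous elements u, v of A
   or M satisfy u v = (-1)^(|u| |v|) v u.  This is the quotient of the tensor
   algebra of M by supercommutation, since the tensor algebra is itself the ring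
   generated by A and the A-bimodule M. *)
Inductive sym_term (A : Type) (M : Type) : Type :=
| SCst of A
| SGen of M
| SAdd of sym_term A M & sym_term A M
| SOpp of sym_term A M
| SMul of sym_term A M & sym_term A M.

Arguments SCst {A M} a.
Arguments SGen {A M} m.

Section Sym.
Variables (A : superComRingType) (M : superLmodType A).

Notation term := (sym_term A M).

HB.instance Definition _ := gen_eqMixin term.
HB.instance Definition _ := gen_choiceMixin term.

Definition sopp_if (b : bool) (t : term) : term := if b then SOpp t else t.

Inductive sym_eqv : term -> term -> Prop :=
| SE_refl t : sym_eqv t t
| SE_sym s t : sym_eqv s t -> sym_eqv t s
| SE_trans s t u : sym_eqv s t -> sym_eqv t u -> sym_eqv s u
| SE_add s s' t t' : sym_eqv s s' -> sym_eqv t t' -> sym_eqv (SAdd s t) (SAdd s' t')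
| SE_opp s s' : sym_eqv s s' -> sym_eqv (SOpp s) (SOpp s')
| SE_mul s s' t t' : sym_eqv s s' -> sym_eqv t t' -> sym_eqv (SMul s t) (SMul s' t')
| SE_addA s t u : sym_eqv (SAdd s (SAdd t u)) (SAdd (SAdd s t) u)
| SE_addC s t : sym_eqv (SAdd s t) (SAdd t s)
| SE_add0 t : sym_eqv (SAdd (SCst 0) t) t
| SE_addN t : sym_eqv (SAdd (SOpp t) t) (SCst 0)
| SE_mulA s t u : sym_eqv (SMul s (SMul t u)) (SMul (SMul s t) u)
| SE_mul1 t : sym_eqv (SMul (SCst 1) t) t
| SE_mulr1 t : sym_eqv (SMul t (SCst 1)) t
| SE_mulDl s t u : sym_eqv (SMul (SAdd s t) u) (SAdd (SMul s u) (SMul t u))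
| SE_mulDr s t u : sym_eqv (SMul s (SAdd t u)) (SAdd (SMul s t) (SMul s u))
| SE_cstD a b : sym_eqv (SCst (a + b)) (SAdd (SCst a) (SCst b))
| SE_cstM a b : sym_eqv (SCst (a * b)) (SMul (SCst a) (SCst b))
| SE_genD m n : sym_eqv (SGen (m + n)) (SAdd (SGen m) (SGen n))
| SE_genZ a m : sym_eqv (SGen (a *: m)) (SMul (SCst a) (SGen m))
| SE_cst_gen b c a m : homog b a -> homog c m ->
    sym_eqv (SMul (SGen m) (SCst a)) (sopp_if (b && c) (SMul (SCst a) (SGen m)))
| SE_gen_gen b c m n : homog b m -> homog c n ->
    sym_eqv (SMul (SGen m) (SGen n)) (sopp_if (b && c) (SMul (SGen n) (SGen m))).

Definition sym_rel : rel term := fun s t => `[< sym_eqv s t >].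

Fact sym_rel_refl : reflexive sym_rel.
Proof. by move=> t; apply/asboolP; exact: SE_refl. Qed.

Fact sym_rel_sym : symmetric sym_rel.
Proof. by move=> s t; apply/asboolP/asboolP; exact: SE_sym. Qed.

Fact sym_rel_trans : transitive sym_rel.
Proof.
move=> t s u /asboolP st /asboolP tu; apply/asboolP; exact: SE_trans st tu.
Qed.

Canonical sym_equiv := EquivRel sym_rel sym_rel_refl sym_rel_sym sym_rel_trans.

Definition Sym : Type := {eq_quot sym_equiv}.

HB.instance Definition _ := Choice.on Sym.
HB.instance Definition _ : EqQuotient _ sym_equiv Sym := EqQuotient.on Sym.

Definition sym_pi (t : term) : Sym := \pi_Sym t.

Lemma sym_piP s t : sym_eqv s t <-> sym_pi s = sym_pi t.
Proof.
split=> [st|/eqmodP/asboolP//]; apply/eqmodP; exact/asboolP.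
Qed.

Lemma sym_pi_surj (x : Sym) : {t | x = sym_pi t}.
Proof. by exists (repr x); rewrite /sym_pi reprK. Qed.

Lemma sym_repr t : sym_eqv (repr (sym_pi t)) t.
Proof. by apply/sym_piP; rewrite /sym_pi reprK. Qed.

Definition sym_zero := sym_pi (SCst 0).
Definition sym_one := sym_pi (SCst 1).
Definition sym_addop (x y : Sym) := sym_pi (SAdd (repr x) (repr y)).
Definition sym_oppop (x : Sym) := sym_pi (SOpp (repr x)).
Definition sym_mulop (x y : Sym) := sym_pi (SMul (repr x) (repr y)).

Fact sym_addopE s t : sym_addop (sym_pi s) (sym_pi t) = sym_pi (SAdd s t).
Proof. by apply/sym_piP; apply: SE_add; exact: sym_repr. Qed.

Fact sym_oppopE s : sym_oppop (sym_pi s) = sym_pi (SOpp s).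
Proof. by apply/sym_piP; apply: SE_opp; exact: sym_repr. Qed.

Fact sym_mulopE s t : sym_mulop (sym_pi s) (sym_pi t) = sym_pi (SMul s t).
Proof. by apply/sym_piP; apply: SE_mul; exact: sym_repr. Qed.

Let opE := (sym_addopE, sym_oppopE, sym_mulopE).

Fact sym_ring_addA : associative sym_addop.
Proof.
move=> x y z; have [s ->] := sym_pi_surj x; have [t ->] := sym_pi_surj y; have [u ->] := sym_pi_surj z.
by rewrite !opE; apply/sym_piP; exact: SE_addA.
Qed.

Fact sym_ring_addC : commutative sym_addop.
Proof.
move=> x y; have [s ->] := sym_pi_surj x; have [t ->] := sym_pi_surj y.
by rewrite !opE; apply/sym_piP; exact: SE_addC.
Qed.

Fact sym_ring_add0 : left_id sym_zero sym_addop.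
Proof.
by move=> x; have [s ->] := sym_pi_surj x; rewrite !opE; apply/sym_piP; exact: SE_add0.
Qed.

Fact sym_ring_addN : left_inverse sym_zero sym_oppop sym_addop.
Proof.
by move=> x; have [s ->] := sym_pi_surj x; rewrite !opE; apply/sym_piP; exact: SE_addN.
Qed.

Fact sym_ring_mulA : associative sym_mulop.
Proof.
move=> x y z; have [s ->] := sym_pi_surj x; have [t ->] := sym_pi_surj y; have [u ->] := sym_pi_surj z.
by rewrite !opE; apply/sym_piP; exact: SE_mulA.
Qed.

Fact sym_ring_mul1 : left_id sym_one sym_mulop.
Proof.
by move=> x; have [s ->] := sym_pi_surj x; rewrite !opE; apply/sym_piP; exact: SE_mul1.
Qed.

Fact sym_ring_mulr1 : right_id sym_one sym_mulop.
Proof.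
by move=> x; have [s ->] := sym_pi_surj x; rewrite !opE; apply/sym_piP; exact: SE_mulr1.
Qed.

Fact sym_ring_mulDl : left_distributive sym_mulop sym_addop.
Proof.
move=> x y z; have [s ->] := sym_pi_surj x; have [t ->] := sym_pi_surj y; have [u ->] := sym_pi_surj z.
by rewrite !opE; apply/sym_piP; exact: SE_mulDl.
Qed.

Fact sym_ring_mulDr : right_distributive sym_mulop sym_addop.
Proof.
move=> x y z; have [s ->] := sym_pi_surj x; have [t ->] := sym_pi_surj y; have [u ->] := sym_pi_surj z.
by rewrite !opE; apply/sym_piP; exact: SE_mulDr.
Qed.

HB.instance Definition _ := GRing.isZmodule.Build Sym
  sym_ring_addA sym_ring_addC sym_ring_add0 sym_ring_addN.
HB.instance Definition _ := GRing.Zmodule_isPzRing.Build Sym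
  sym_ring_mulA sym_ring_mul1 sym_ring_mulr1 sym_ring_mulDl sym_ring_mulDr.

Definition sym_cst (a : A) : Sym := sym_pi (SCst a).
Definition sym_gen (m : M) : Sym := sym_pi (SGen m).

Lemma sym_piD s t : sym_pi (SAdd s t) = sym_pi s + sym_pi t.
Proof. by rewrite -sym_addopE. Qed.

Lemma sym_piN s : sym_pi (SOpp s) = - sym_pi s.
Proof. by rewrite -sym_oppopE. Qed.

Lemma sym_piM s t : sym_pi (SMul s t) = sym_pi s * sym_pi t.
Proof. by rewrite -sym_mulopE. Qed.

Lemma sym_cst0 : sym_cst 0 = 0. Proof. by []. Qed.
Lemma sym_cst1 : sym_cst 1 = 1. Proof. by []. Qed.

Lemma sym_cstD a b : sym_cst (a + b) = sym_cst a + sym_cst b.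
Proof. by rewrite -sym_piD; apply/sym_piP; exact: SE_cstD. Qed.

Lemma sym_cstM a b : sym_cst (a * b) = sym_cst a * sym_cst b.
Proof. by rewrite -sym_piM; apply/sym_piP; exact: SE_cstM. Qed.

Lemma sym_genD m n : sym_gen (m + n) = sym_gen m + sym_gen n.
Proof. by rewrite -sym_piD; apply/sym_piP; exact: SE_genD. Qed.

Lemma sym_gen_scale a m : sym_gen (a *: m) = sym_cst a * sym_gen m.
Proof. by rewrite -sym_piM; apply/sym_piP; exact: SE_genZ. Qed.


Lemma sym_gen0 : sym_gen 0 = 0.
Proof. by apply: (addrI (sym_gen 0)); rewrite -sym_genD !addr0. Qed.

Lemma sym_pi_oppif b t : sym_pi (sopp_if b t) = if b then - sym_pi t else sym_pi t.
Proof. by case: b; rewrite /= ?sym_piN. Qed.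

Lemma sym_gen_cst b c a m : homog b a -> homog c m ->
  sym_gen m * sym_cst a =
    if b && c then - (sym_cst a * sym_gen m) else sym_cst a * sym_gen m.
Proof.
by move=> ha hm; rewrite -!sym_piM -sym_pi_oppif; apply/sym_piP; exact: SE_cst_gen.
Qed.

Lemma sym_gen_genC b c m n : homog b m -> homog c n ->
  sym_gen m * sym_gen n =
    if b && c then - (sym_gen n * sym_gen m) else sym_gen n * sym_gen m.
Proof.
by move=> ha hm; rewrite -!sym_piM -sym_pi_oppif; apply/sym_piP; exact: SE_gen_gen.
Qed.

Definition sym_scale (a : A) (x : Sym) : Sym := sym_cst a * x.

Fact sym_scaleA a b x : sym_scale a (sym_scale b x) = sym_scale (a * b) x.
Proof. by rewrite /sym_scale mulrA sym_cstM. Qed.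

Fact sym_scale1 : left_id 1 sym_scale.
Proof. by move=> x; rewrite /sym_scale sym_cst1 mul1r. Qed.

Fact sym_scaleDr : right_distributive sym_scale +%R.
Proof. by move=> a x y; rewrite /sym_scale mulrDr. Qed.

Fact sym_scaleDl x : {morph sym_scale^~ x : a b / a + b}.
Proof. by move=> a b; rewrite /sym_scale sym_cstD mulrDl. Qed.

HB.instance Definition _ :=
  GRing.Zmodule_isLmodule.Build A Sym sym_scaleA sym_scale1 sym_scaleDr sym_scaleDl.

Lemma sym_scaleE a (x : Sym) : a *: x = sym_cst a * x.
Proof. by []. Qed.

(* The grading, by recursion on the expression. *)
Fixpoint sym_tpart (t : term) (b : bool) : Sym :=
  match t with
  | SCst a => sym_cst (part b a)
  | SGen m => sym_gen (part b m)
  | SAdd s t => sym_tpart s b + sym_tpart t b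
  | SOpp s => - sym_tpart s b
  | SMul s t => sym_tpart s false * sym_tpart t b + sym_tpart s true * sym_tpart t (~~ b)
  end.

Fact sym_tpart_oppif e t b :
  sym_tpart (sopp_if e t) b = if e then - sym_tpart t b else sym_tpart t b.
Proof. by case: e. Qed.

Fact sym_tpart_eqv s t : sym_eqv s t -> forall b, sym_tpart s b = sym_tpart t b.
Proof.
elim=> {s t} /=.
- by [].
- by move=> s t _ IH b; rewrite IH.
- by move=> s t u _ IH _ IH' b; rewrite IH.
- by move=> s s' t t' _ IH _ IH' b; rewrite IH IH'.
- by move=> s s' _ IH b; rewrite IH.
- by move=> s s' t t' _ IH _ IH' b; rewrite !IH !IH'.
- by move=> s t u b; rewrite addrA.
- by move=> s t b; rewrite addrC.
- by move=> t b; rewrite part0 sym_cst0 add0r.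
- by move=> t b; rewrite part0 sym_cst0 addNr.
- move=> s t u b; rewrite negbK !mulrDr !mulrDl !mulrA /=.
  rewrite -!addrA; congr (_ + _).
  by rewrite addrA addrC.
- move=> t b; rewrite !(part_homog _ homog1) /= sym_cst1 sym_cst0.
  by rewrite mul1r mul0r addr0.
- move=> t b; rewrite !(part_homog _ homog1).
  by case: b; rewrite /= sym_cst1 sym_cst0 mulr1 mulr0 ?addr0 ?add0r.
- by move=> s t u b; rewrite !mulrDl addrACA.
- by move=> s t u b; rewrite !mulrDr addrACA.
- by move=> a c b; rewrite partD sym_cstD.
- by move=> a c b; rewrite partM sym_cstD !sym_cstM.
- by move=> m n b; rewrite partD sym_genD.
- by move=> a m b; rewrite partZ sym_genD !sym_gen_scale.
- move=> b c a m ha hm d; rewrite sym_tpart_oppif /= !(part_homog _ ha) !(part_homog _ hm).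
  move: (sym_gen_cst ha hm).
  case: b {ha}; case: c {hm}; case: d => /= e;
  by rewrite ?sym_gen0 ?sym_cst0 ?mul0r ?mulr0 ?addr0 ?add0r ?oppr0.
- move=> b c m n hm hn d; rewrite sym_tpart_oppif /= !(part_homog _ hm) !(part_homog _ hn).
  move: (sym_gen_genC hm hn).
  case: b {hm}; case: c {hn}; case: d => /= e;
  by rewrite ?sym_gen0 ?sym_cst0 ?mul0r ?mulr0 ?addr0 ?add0r ?oppr0.
Qed.

Definition sym_part (b : bool) (x : Sym) : Sym := sym_tpart (repr x) b.

Lemma sym_partE b t : sym_part b (sym_pi t) = sym_tpart t b.
Proof. exact/sym_tpart_eqv/sym_repr. Qed.

Fact sym_partD b : {morph sym_part b : x y / x + y}.
Proof.
move=> x y; have [s ->] := sym_pi_surj x; have [t ->] := sym_pi_surj y.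
by rewrite -sym_piD !sym_partE.
Qed.

Fact sym_partN b x : sym_part b (- x) = - sym_part b x.
Proof. by have [s ->] := sym_pi_surj x; rewrite -sym_piN !sym_partE. Qed.

Fact sym_partM b x y : sym_part b (x * y) =
  sym_part false x * sym_part b y + sym_part true x * sym_part (~~ b) y.
Proof.
have [s ->] := sym_pi_surj x; have [t ->] := sym_pi_surj y.
by rewrite -sym_piM !sym_partE.
Qed.

Fact sym_part_cst b a : sym_part b (sym_cst a) = sym_cst (part b a).
Proof. exact: sym_partE. Qed.

Fact sym_part_gen b m : sym_part b (sym_gen m) = sym_gen (part b m).
Proof. exact: sym_partE. Qed.

(* Induction over the generators of the ring. *)
Lemma Sym_ind (P : Sym -> Prop) :
  (forall a, P (sym_cst a)) -> (forall m, P (sym_gen m)) ->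
  (forall x y, P x -> P y -> P (x + y)) -> (forall x, P x -> P (- x)) ->
  (forall x y, P x -> P y -> P (x * y)) -> forall x, P x.
Proof.
move=> Pc Pg PD PN PM x; have [t ->] := sym_pi_surj x.
elim: t => [a|m|s IHs t IHt|s IHs|s IHs t IHt].
- exact: Pc.
- exact: Pg.
- by rewrite sym_piD; exact: PD.
- by rewrite sym_piN; exact: PN.
- by rewrite sym_piM; exact: PM.
Qed.

Fact sym_part_part b c x :
  sym_part b (sym_part c x) = if b == c then sym_part c x else 0.
Proof.
elim/Sym_ind: x b c => [a|m|x y IHx IHy|x IHx|x y IHx IHy] b c.
- by rewrite !sym_part_cst part_part; case: eqP => // _; rewrite sym_cst0.
- by rewrite !sym_part_gen part_part; case: eqP => // _; rewrite sym_gen0.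
- by rewrite !sym_partD IHx IHy; case: eqP => // _; rewrite addr0.
- by rewrite !sym_partN IHx; case: eqP => // _; rewrite oppr0.
- rewrite !sym_partM sym_partD !sym_partM !IHx !IHy.
  by case: b; case: c; rewrite /= ?mul0r ?mulr0 ?addr0 ?add0r.
Qed.

Fact sym_part_sum x : sym_part false x + sym_part true x = x.
Proof.
elim/Sym_ind: x => [a|m|x y IHx IHy|x IHx|x y IHx IHy].
- by rewrite !sym_part_cst -sym_cstD part_sum.
- by rewrite !sym_part_gen -sym_genD part_sum.
- by rewrite !sym_partD addrACA IHx IHy.
- by rewrite !sym_partN -opprD IHx.
- rewrite !sym_partM /= -[in RHS]IHx -[in RHS]IHy mulrDl !mulrDr.
  by rewrite addrACA [_ * _ + _ * _ in X in _ + X = _]addrC.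
Qed.

HB.instance Definition _ := isSuper.Build Sym sym_partD sym_part_part sym_part_sum.

Lemma part_cst b a : part b (sym_cst a) = sym_cst (part b a).
Proof. exact: sym_part_cst. Qed.

Lemma part_gen b m : part b (sym_gen m) = sym_gen (part b m).
Proof. exact: sym_part_gen. Qed.

Lemma homog_cst b a : homog b a -> homog b (sym_cst a).
Proof. by move=> /homogP ha; apply/homogP; rewrite part_cst ha. Qed.

Lemma homog_gen b m : homog b m -> homog b (sym_gen m).
Proof. by move=> /homogP ha; apply/homogP; rewrite part_gen ha. Qed.

Fact sym_homog1 : homog false (1 : Sym).
Proof. by apply: homog_cst; exact: homog1. Qed.

Fact sym_homogM b c (x y : Sym) : homog b x -> homog c y -> homog (b (+) c) (x * y).
Proof.
move=> hx hy; apply/homogP; rewrite [LHS]sym_partM.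
rewrite ![sym_part _ x](part_homog _ hx) ![sym_part _ y](part_homog _ hy).
by case: b {hx}; case: c {hy}; rewrite /= ?mul0r ?mulr0 ?addr0 ?add0r.
Qed.

HB.instance Definition _ := isSuperRing.Build Sym sym_homog1 sym_homogM.

Fact sym_homogZ b c (a : A) (x : Sym) :
  homog b a -> homog c x -> homog (b (+) c) (a *: x).
Proof. by move=> ha hx; apply: sym_homogM => //; exact: homog_cst. Qed.

HB.instance Definition _ := isSuperLmodule.Build A Sym sym_homogZ.

Definition scomm (x y : Sym) : Prop := forall b c,
  part b x * part c y =
    if b && c then - (part c y * part b x) else part c y * part b x.

Fact scomm_sym x y : scomm x y -> scomm y x.
Proof. by move=> h b c; have := h c b; case: b; case: c => /= ->; rewrite ?opprK. Qed.

Fact scommD x y z : scomm x z -> scomm y z -> scomm (x + y) z.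
Proof.
move=> h h' b c; rewrite partD mulrDl mulrDr h h'; case: ifP => // _.
by rewrite opprD.
Qed.

Fact scommN x z : scomm x z -> scomm (- x) z.
Proof.
move=> h b c; rewrite partN mulNr mulrN h; case: ifP => // _.
Qed.

Fact scommM x y z : scomm x z -> scomm y z -> scomm (x * y) z.
Proof.
move=> h h' b c; rewrite partM mulrDl mulrDr -!mulrA !h' !mulrA.
have e u d : part u x * part d z = if u && d then - (part d z * part u x)
  else part d z * part u x by exact: h.
case: b; case: c => /=; rewrite ?mulrN ?mulNr !mulrA !e /= ?mulNr ?opprD ?opprK //.
Qed.

Fact scomm_all x y : scomm x y.
Proof.
elim/Sym_ind: x y => [a|m|x y IHx IHy|x IHx|x y IHx IHy] z; last 1 first.
- exact: scommM.
- apply/scomm_sym; elim/Sym_ind: z => [a'|m|x y IHx IHy|x IHx|x y IHx IHy].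
  + move=> b c; rewrite !part_cst -!sym_cstM.
    rewrite (supermulC _ _ _ _ (homog_part b a') (homog_part c a)).
    case: ifP => _; rewrite ?mul1r // mulN1r.
    by apply/eqP; rewrite -addr_eq0 -sym_cstD addNr.
  + move=> b c; rewrite part_cst part_gen andbC.
    exact: sym_gen_cst (homog_part _ _) (homog_part _ _).
  + exact: scommD.
  + exact: scommN.
  + exact: scommM.
- apply/scomm_sym; elim/Sym_ind: z => [a|n|x y IHx IHy|x IHx|x y IHx IHy].
  + apply/scomm_sym => b c; rewrite part_cst part_gen andbC.
    exact: sym_gen_cst (homog_part _ _) (homog_part _ _).
  + move=> b c; rewrite !part_gen.
    exact: sym_gen_genC (homog_part _ _) (homog_part _ _).
  + exact: scommD.
  + exact: scommN.
  + exact: scommM.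
- exact: scommD.
- exact: scommN.
Qed.

Fact sym_supermulC b c (x y : Sym) :
  homog b x -> homog c y -> x * y = (-1) ^+ (b && c) * (y * x).
Proof.
move=> /homogP hx /homogP hy; have := scomm_all x y b c; rewrite hx hy => ->.
by case: (b && c); rewrite ?mulN1r ?mul1r.
Qed.

HB.instance Definition _ := isSuperCom.Build Sym sym_supermulC.

(* Sym^k M, as a subset of Sym M. *)
Definition sympow (k : nat) : Sym -> Prop :=
  sums_of (fun x => exists a (t : k.-tuple M), x = a *: \prod_(m <- t) sym_gen m).

Fact sympow_seq a (s : seq M) : sympow (size s) (a *: \prod_(m <- s) sym_gen m).
Proof. by apply: sums_of1; exists a, (in_tuple s). Qed.

Fact sympowZ k a x : sympow k x -> sympow k (a *: x).
Proof.
move=> hx; apply: (sums_of_map (f := fun y => a *: y)) hx => [||y]; first exact: scaler0.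
  exact: scalerDr.
by case=> b [t ->]; apply: sums_of1; exists (a * b), t; rewrite scalerA.
Qed.

Fact sympow_gen k m x : sympow k x -> sympow k.+1 (sym_gen m * x).
Proof.
move=> hx; apply: (sums_of_map (f := fun y => sym_gen m * y)) hx => [||y].
- exact: mulr0.
- exact: mulrDr.
case=> a [t ->]; rewrite sym_scaleE mulrA (supermulE (sym_gen m)) mulrDl.
rewrite /bar !part_cst !part_gen mulrBr mulrBl.
have h n b : sympow k.+1 (sym_cst (part b a) * sym_gen n * \prod_(i <- t) sym_gen i).
  by have := sympow_seq (part b a) (n :: t); rewrite big_cons /= size_tuple sym_scaleE mulrA.
apply: sums_ofD; first exact: h.
apply: sums_ofD; first exact: h.
by rewrite -scaleN1r; apply: sympowZ; exact: h.
Qed.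

Fact sympow_part k b x : sympow k x -> sympow k (part b x).
Proof.
move=> hx; apply: (sums_of_map (f := part b)) hx => [||y]; first exact: part0.
  exact: partD.
case=> a [t ->]; rewrite partZ.
suff h (s : seq M) c : sympow (size s) (part c (\prod_(m <- s) sym_gen m)).
  by have := h t; rewrite size_tuple => ht; apply: sums_ofD; exact: sympowZ.
elim: s c => [|m s IH] c.
  rewrite big_nil; have := sympow_seq (part c 1) [::].
  by rewrite big_nil sym_scaleE mulr1 -part_cst.
by rewrite big_cons partM !part_gen; apply: sums_ofD; exact: sympow_gen.
Qed.

End Sym.

(* The tensor product M (x)_A N, over the right action on M: the abelian group
   generated by the symbols m (x) n, biadditive and with m a (x) n = m (x) a n. *)
Inductive tens_term (M N : Type) : Type :=
| TZero
| TPure of M & N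
| TAdd of tens_term M N & tens_term M N
| TOpp of tens_term M N.

Arguments TZero {M N}.

Section Tensor.
Variables (A : superComRingType) (M N : superLmodType A).

Notation term := (tens_term M N).

HB.instance Definition _ := gen_eqMixin term.
HB.instance Definition _ := gen_choiceMixin term.

Inductive tens_eqv : term -> term -> Prop :=
| TE_refl t : tens_eqv t t
| TE_sym s t : tens_eqv s t -> tens_eqv t s
| TE_trans s t u : tens_eqv s t -> tens_eqv t u -> tens_eqv s u
| TE_add s s' t t' : tens_eqv s s' -> tens_eqv t t' -> tens_eqv (TAdd s t) (TAdd s' t')
| TE_opp s s' : tens_eqv s s' -> tens_eqv (TOpp s) (TOpp s')
| TE_addA s t u : tens_eqv (TAdd s (TAdd t u)) (TAdd (TAdd s t) u)
| TE_addC s t : tens_eqv (TAdd s t) (TAdd t s)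
| TE_add0 t : tens_eqv (TAdd TZero t) t
| TE_addN t : tens_eqv (TAdd (TOpp t) t) TZero
| TE_pureDl m m' n : tens_eqv (TPure (m + m') n) (TAdd (TPure m n) (TPure m' n))
| TE_pureDr m n n' : tens_eqv (TPure m (n + n')) (TAdd (TPure m n) (TPure m n'))
| TE_pureZ m a n : tens_eqv (TPure (rscale m a) n) (TPure m (a *: n)).

Definition tens_rel : rel term := fun s t => `[< tens_eqv s t >].

Fact tens_rel_refl : reflexive tens_rel.
Proof. by move=> t; apply/asboolP; exact: TE_refl. Qed.

Fact tens_rel_sym : symmetric tens_rel.
Proof. by move=> s t; apply/asboolP/asboolP; exact: TE_sym. Qed.

Fact tens_rel_trans : transitive tens_rel.
Proof.
move=> t s u /asboolP st /asboolP tu; apply/asboolP; exact: TE_trans st tu.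
Qed.

Canonical tens_equiv := EquivRel tens_rel tens_rel_refl tens_rel_sym tens_rel_trans.

Definition Tensor : Type := {eq_quot tens_equiv}.

HB.instance Definition _ := Choice.on Tensor.
HB.instance Definition _ : EqQuotient _ tens_equiv Tensor := EqQuotient.on Tensor.

Definition tens_pi (t : term) : Tensor := \pi_Tensor t.

Lemma tens_piP s t : tens_eqv s t <-> tens_pi s = tens_pi t.
Proof.
split=> [st|/eqmodP/asboolP//]; apply/eqmodP; exact/asboolP.
Qed.

Lemma tens_pi_surj (x : Tensor) : {t | x = tens_pi t}.
Proof. by exists (repr x); rewrite /tens_pi reprK. Qed.

Lemma tens_repr t : tens_eqv (repr (tens_pi t)) t.
Proof. by apply/tens_piP; rewrite /tens_pi reprK. Qed.

Definition tens_zero := tens_pi TZero.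
Definition tens_addop (x y : Tensor) := tens_pi (TAdd (repr x) (repr y)).
Definition tens_oppop (x : Tensor) := tens_pi (TOpp (repr x)).

Fact tens_addopE s t : tens_addop (tens_pi s) (tens_pi t) = tens_pi (TAdd s t).
Proof. by apply/tens_piP; apply: TE_add; exact: tens_repr. Qed.

Fact tens_oppopE s : tens_oppop (tens_pi s) = tens_pi (TOpp s).
Proof. by apply/tens_piP; apply: TE_opp; exact: tens_repr. Qed.

Let opE := (tens_addopE, tens_oppopE).

Fact tens_addA : associative tens_addop.
Proof.
move=> x y z; have [s ->] := tens_pi_surj x; have [t ->] := tens_pi_surj y.
have [u ->] := tens_pi_surj z; rewrite !opE; apply/tens_piP; exact: TE_addA.
Qed.

Fact tens_addC : commutative tens_addop.
Proof.
move=> x y; have [s ->] := tens_pi_surj x; have [t ->] := tens_pi_surj y.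
by rewrite !opE; apply/tens_piP; exact: TE_addC.
Qed.

Fact tens_add0 : left_id tens_zero tens_addop.
Proof.
by move=> x; have [s ->] := tens_pi_surj x; rewrite !opE; apply/tens_piP; exact: TE_add0.
Qed.

Fact tens_addN : left_inverse tens_zero tens_oppop tens_addop.
Proof.
by move=> x; have [s ->] := tens_pi_surj x; rewrite !opE; apply/tens_piP; exact: TE_addN.
Qed.

HB.instance Definition _ := GRing.isZmodule.Build Tensor
  tens_addA tens_addC tens_add0 tens_addN.

Definition tens (m : M) (n : N) : Tensor := tens_pi (TPure m n).

Lemma tens_piD s t : tens_pi (TAdd s t) = tens_pi s + tens_pi t.
Proof. by rewrite -tens_addopE. Qed.

Lemma tens_piN s : tens_pi (TOpp s) = - tens_pi s.
Proof. by rewrite -tens_oppopE. Qed.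

Lemma tensDl m m' n : tens (m + m') n = tens m n + tens m' n.
Proof. by rewrite -tens_piD; apply/tens_piP; exact: TE_pureDl. Qed.

Lemma tensDr m n n' : tens m (n + n') = tens m n + tens m n'.
Proof. by rewrite -tens_piD; apply/tens_piP; exact: TE_pureDr. Qed.

Lemma tens_rscale m a n : tens (rscale m a) n = tens m (a *: n).
Proof. by apply/tens_piP; exact: TE_pureZ. Qed.

Lemma tens0l n : tens 0 n = 0.
Proof. by apply: (addrI (tens 0 n)); rewrite -tensDl !addr0. Qed.

Lemma tens0r m : tens m 0 = 0.
Proof. by apply: (addrI (tens m 0)); rewrite -tensDr !addr0. Qed.

Lemma tensNl m n : tens (- m) n = - tens m n.
Proof. by apply/eqP; rewrite -addr_eq0 -tensDl addNr tens0l. Qed.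

Lemma tensNr m n : tens m (- n) = - tens m n.
Proof. by apply/eqP; rewrite -addr_eq0 -tensDr addNr tens0r. Qed.

Lemma Tensor_ind (P : Tensor -> Prop) :
  (forall m n, P (tens m n)) -> (forall x y, P x -> P y -> P (x + y)) -> forall x, P x.
Proof.
move=> Pp PD x; have [t ->] := tens_pi_surj x.
suff: P (tens_pi t) /\ P (- tens_pi t) by case.
elim: t => [|m n|s [IHs IHs'] t [IHt IHt']|s [IHs IHs']].
- by rewrite -[tens_pi TZero](tens0l 0) -tensNl; split; exact: Pp.
- by rewrite -[tens_pi _]/(tens m n) -tensNl; split; exact: Pp.
- by rewrite tens_piD opprD; split; exact: PD.
- by rewrite tens_piN opprK.
Qed.

(* Biadditive balanced maps factor through the tensor product. *)
Section Lift.
Variables (G : zmodType) (f : M -> N -> G).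

Definition balanced : Prop :=
  [/\ forall m m' n, f (m + m') n = f m n + f m' n,
      forall m n n', f m (n + n') = f m n + f m n' &
      forall m a n, f (rscale m a) n = f m (a *: n)].

Fixpoint tens_eval (t : term) : G :=
  match t with
  | TZero => 0
  | TPure m n => f m n
  | TAdd s t => tens_eval s + tens_eval t
  | TOpp s => - tens_eval s
  end.

Definition tlift (x : Tensor) : G := tens_eval (repr x).

Hypothesis fB : balanced.

Fact tens_eval_eqv s t : tens_eqv s t -> tens_eval s = tens_eval t.
Proof.
case: fB => fDl fDr fZ; elim=> {s t} //=.
- by move=> s t u _ -> _ ->.
- by move=> s s' t t' _ -> _ ->.
- by move=> s s' _ ->.
- by move=> s t u; rewrite addrA.
- by move=> s t; rewrite addrC.
- by move=> t; rewrite add0r.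
- by move=> t; rewrite addNr.
Qed.

Fact tlift_pi t : tlift (tens_pi t) = tens_eval t.
Proof. exact/tens_eval_eqv/tens_repr. Qed.

Lemma tliftE m n : tlift (tens m n) = f m n.
Proof. exact: tlift_pi. Qed.

Lemma tliftD : {morph tlift : x y / x + y}.
Proof.
move=> x y; have [s ->] := tens_pi_surj x; have [t ->] := tens_pi_surj y.
by rewrite -tens_piD !tlift_pi.
Qed.

End Lift.

(* A-module structure and grading *)

Definition tens_scale (a : A) : Tensor -> Tensor := tlift (fun m n => tens (a *: m) n).

Fact tens_scale_balanced a : balanced (fun m n => tens (a *: m) n).
Proof.
split=> [m m' n|m n n'|m b n].
- by rewrite scalerDr tensDl.
- exact: tensDr.
- by rewrite -rscaleZ tens_rscale.
Qed.

Fact tens_scaleE a m n : tens_scale a (tens m n) = tens (a *: m) n.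
Proof. exact/tliftE/tens_scale_balanced. Qed.

Fact tens_scaleDr : right_distributive tens_scale +%R.
Proof. by move=> a; exact/tliftD/tens_scale_balanced. Qed.

Fact tens_scaleDl x : {morph tens_scale^~ x : a b / a + b}.
Proof.
move=> a b; elim/Tensor_ind: x => [m n|x y IHx IHy].
  by rewrite !tens_scaleE scalerDl tensDl.
by rewrite !tens_scaleDr IHx IHy addrACA.
Qed.

Fact tens_scaleA a b x : tens_scale a (tens_scale b x) = tens_scale (a * b) x.
Proof.
elim/Tensor_ind: x => [m n|x y IHx IHy]; first by rewrite !tens_scaleE scalerA.
by rewrite !tens_scaleDr IHx IHy.
Qed.

Fact tens_scale1 : left_id 1 tens_scale.
Proof.
elim/Tensor_ind=> [m n|x y IHx IHy]; first by rewrite !tens_scaleE scale1r.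
by rewrite !tens_scaleDr IHx IHy.
Qed.

HB.instance Definition _ :=
  GRing.Zmodule_isLmodule.Build A Tensor tens_scaleA tens_scale1 tens_scaleDr tens_scaleDl.

Lemma tensZ a m n : a *: tens m n = tens (a *: m) n.
Proof. exact: tens_scaleE. Qed.

Definition tens_part_fun b (m : M) (n : N) : Tensor :=
  tens (part false m) (part b n) + tens (part true m) (part (~~ b) n).

Definition tens_part (b : bool) : Tensor -> Tensor := tlift (tens_part_fun b).

Fact tens_part_balanced b : balanced (tens_part_fun b).
Proof.
rewrite /tens_part_fun; split=> [m m' n|m n n'|m a n].
- by rewrite !partD !tensDl addrACA.
- by rewrite !partD !tensDr addrACA.
- have e x y u v n' : tens (rscale x u + rscale y v) n' = tens x (u *: n') + tens y (v *: n').
    by rewrite tensDl !tens_rscale.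
  rewrite !part_rscale !e !partZ negbK !tensDr.
  by rewrite addrACA [X in _ + X = _]addrC addrACA [X in _ + X]addrC.
Qed.

Fact tens_partE b m n : tens_part b (tens m n) = tens_part_fun b m n.
Proof. exact/tliftE/tens_part_balanced. Qed.

Fact tens_partD b : {morph tens_part b : x y / x + y}.
Proof. exact/tliftD/tens_part_balanced. Qed.

Fact tens_part_part b c x : tens_part b (tens_part c x) = if b == c then tens_part c x else 0.
Proof.
elim/Tensor_ind: x => [m n|x y IHx IHy].
  rewrite !tens_partE tens_partD !tens_partE /tens_part_fun !part_part.
  by case: b; case: c; rewrite /= !(tens0l, tens0r) ?addr0 ?add0r.
by rewrite !tens_partD IHx IHy; case: eqP => // _; rewrite addr0.
Qed.

Fact tens_part_sum x : tens_part false x + tens_part true x = x.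
Proof.
elim/Tensor_ind: x => [m n|x y IHx IHy].
  rewrite !tens_partE /tens_part_fun /= addrACA -tensDr part_sum.
  by rewrite [X in _ + X]addrC -tensDr part_sum -tensDl part_sum.
by rewrite !tens_partD addrACA IHx IHy.
Qed.

HB.instance Definition _ := isSuper.Build Tensor tens_partD tens_part_part tens_part_sum.

Lemma part_tens b m n : part b (tens m n) =
  tens (part false m) (part b n) + tens (part true m) (part (~~ b) n).
Proof. exact: tens_partE. Qed.

Lemma homog_tens b c m n : homog b m -> homog c n -> homog (b (+) c) (tens m n).
Proof.
move=> hm hn; apply/homogP; rewrite part_tens !(part_homog _ hm) !(part_homog _ hn).
by case: b {hm}; case: c {hn}; rewrite /= ?tens0l ?tens0r ?addr0 ?add0r.
Qed.

Fact tens_homogZ b c (a : A) (x : Tensor) :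
  homog b a -> homog c x -> homog (b (+) c) (a *: x).
Proof.
move=> ha /homogP hx; apply/homogP.
have h d : part d (a *: x) = a *: part (d (+) b) x.
  elim/Tensor_ind: x {hx} => [m n|x y IHx IHy].
    rewrite tensZ !part_tens !(partZ_even _ _ ha) scalerDr !tensZ.
    by case: b d {ha} => [] []; rewrite /= // addrC.
  by rewrite scalerDr !partD IHx IHy scalerDr.
by rewrite h -[in RHS]hx; case: b c {ha hx h} => [] [].
Qed.

HB.instance Definition _ := isSuperLmodule.Build A Tensor tens_homogZ.

End Tensor.

(* The superalgebra Sym M (x)_A Sym N, with
   (r (x) s) (r' (x) s') = (-1)^(|s| |r'|) r r' (x) s s'. *)
Section SymScalars.
Variables (A : superComRingType) (L : superLmodType A).
Implicit Types (x y : Sym L) (a : A).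

Lemma sym_rscaleE x a : rscale x a = x * sym_cst L a.
Proof. by rewrite supermulE !part_cst. Qed.

Lemma bar_cst a : bar (sym_cst L a) = sym_cst L (bar a).
Proof.
rewrite {1}/bar !part_cst /bar sym_cstD; congr (_ + _).
by apply/eqP; rewrite eq_sym -addr_eq0 -sym_cstD addNr.
Qed.

Lemma sym_cst_mulE x a :
  sym_cst L a * x = x * sym_cst L (part false a) + bar x * sym_cst L (part true a).
Proof.
rewrite -!sym_rscaleE /rscale barK !part_part /= !scale0r addr0 add0r.
by rewrite -scalerDl part_sum.
Qed.

Lemma sym_mul_rscale x y a : x * rscale y a = rscale (x * y) a.
Proof. by rewrite !sym_rscaleE mulrA. Qed.

Lemma sym_bar_rscale x a : bar (rscale x a) = rscale (bar x) (bar a).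
Proof. by rewrite !sym_rscaleE barM bar_cst. Qed.

Lemma sym_even_scale x y a : part false x * (a *: y) = a *: (part false x * y).
Proof.
rewrite !sym_scaleE !mulrA -sym_rscaleE /rscale (bar_homog (homog_part _ _)).
by rewrite -scalerDl part_sum.
Qed.

Lemma sym_odd_scale x y a : part true x * (a *: y) = bar a *: (part true x * y).
Proof.
rewrite !sym_scaleE !mulrA -sym_rscaleE /rscale (bar_homog (homog_part _ _)).
by rewrite scalerN -scalerBl.
Qed.

End SymScalars.

Section TensorAlgebra.
Variables (A : superComRingType) (M N : superLmodType A).

Local Notation R := (Sym M).
Local Notation S := (Sym N).
Local Notation T := (Tensor R S).

Definition tmul_pure (r : R) (s : S) (r' : R) (s' : S) : T :=
  tens (r * r') (part false s * s') + tens (r * bar r') (part true s * s').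

Definition tmul (x y : T) : T := tlift (fun r s => tlift (tmul_pure r s) y) x.

Fact tmul_pure_balanced r s : balanced (tmul_pure r s).
Proof.
rewrite /tmul_pure; split=> [m m' n|m n n'|m a n].
- by rewrite barD !mulrDr !tensDl addrACA.
- by rewrite !mulrDr !tensDr addrACA.
- by rewrite sym_bar_rscale !sym_mul_rscale !tens_rscale sym_even_scale sym_odd_scale.
Qed.

Fact tlift_tmulD r s : {morph tlift (tmul_pure r s) : x y / x + y}.
Proof. exact/tliftD/tmul_pure_balanced. Qed.

Fact tlift_tmulE r s m n : tlift (tmul_pure r s) (tens m n) = tmul_pure r s m n.
Proof. exact/tliftE/tmul_pure_balanced. Qed.

Fact tmul_balanced y : balanced (fun r s => tlift (tmul_pure r s) y).
Proof.
split=> [m m' n|m n n'|m a n]; elim/Tensor_ind: y => [r s|y z IHy IHz];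
  rewrite ?tlift_tmulE ?tlift_tmulD ?IHy ?IHz 1?addrACA // /tmul_pure.
- by rewrite !mulrDl !tensDl addrACA.
- by rewrite !partD !mulrDl !tensDr addrACA.
- rewrite !sym_rscaleE -!mulrA !sym_cst_mulE barK.
  move: (bar r) => r1; rewrite !mulrDr !tensDl !mulrA.
  rewrite -!sym_rscaleE !tens_rscale !partZ /= !mulrDl !tensDr.
  rewrite !sym_scaleE !mulrA.
  by rewrite addrACA [RHS]addrACA; congr (_ + _); rewrite addrC.
Qed.

Fact tmulE r s r' s' : tmul (tens r s) (tens r' s') = tmul_pure r s r' s'.
Proof. by rewrite /tmul (tliftE (tmul_balanced _)) tlift_tmulE. Qed.

Fact tmulDl : left_distributive tmul +%R.
Proof. by move=> x y z; rewrite /tmul (tliftD (tmul_balanced _)). Qed.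

Fact tmulDr : right_distributive tmul +%R.
Proof.
move=> x y z; elim/Tensor_ind: x => [r s|x x' IH IH'].
  by rewrite /tmul !(tliftE (tmul_balanced _)) tlift_tmulD.
by rewrite !tmulDl IH IH' addrACA.
Qed.

Fact tmulA : associative tmul.
Proof.
move=> x y z; elim/Tensor_ind: x => [r s|x x' IH IH']; last by rewrite !tmulDl IH IH'.
elim/Tensor_ind: y => [r' s'|y y' IH IH'].
  elim/Tensor_ind: z => [r'' s''|z z' IH IH']; last by rewrite !tmulDr IH IH'.
  rewrite !tmulE /tmul_pure tmulDl tmulDr !tmulE /tmul_pure !barM barK.
  rewrite !partM !part_part /= ?mul0r ?addr0 ?add0r !mulrA.
  by rewrite addrACA; congr (_ + _); rewrite addrC.
by rewrite !(tmulDl, tmulDr) IH IH'.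
Qed.

Fact tmul1 : left_id (tens (1 : R) (1 : S)) tmul.
Proof.
elim/Tensor_ind=> [r s|x y IHx IHy]; last by rewrite tmulDr IHx IHy.
rewrite tmulE /tmul_pure !(part_homog _ homog1) /= !mul1r mul0r.
by rewrite tens0r addr0.
Qed.

Fact tmulr1 : right_id (tens (1 : R) (1 : S)) tmul.
Proof.
elim/Tensor_ind=> [r s|x y IHx IHy]; last by rewrite tmulDl IHx IHy.
rewrite tmulE /tmul_pure (bar_homog homog1) !mulr1.
by rewrite -tensDr part_sum.
Qed.

HB.instance Definition _ :=
  GRing.Zmodule_isPzRing.Build T tmulA tmul1 tmulr1 tmulDl tmulDr.

Lemma tensM (r r' : R) (s s' : S) : tens r s * tens r' s' =
  tens (r * r') (part false s * s') + tens (r * bar r') (part true s * s').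
Proof. exact: tmulE. Qed.

Lemma tensM_homog b c (r r' : R) (s s' : S) : homog b s -> homog c r' ->
  tens r s * tens r' s' = if b && c then - tens (r * r') (s * s')
                          else tens (r * r') (s * s').
Proof.
move=> hs hr; rewrite tensM !(part_homog _ hs) (bar_homog hr).
by case: b {hs}; case: c {hr}; rewrite /= ?mul0r ?tens0r ?addr0 ?add0r // mulrN tensNl.
Qed.

(* Induction over homogeneous generators. *)
Lemma Tensor_homog_ind (P : T -> Prop) :
  (forall b c r s, homog b r -> homog c s -> P (tens r s)) ->
  (forall x y, P x -> P y -> P (x + y)) -> forall x, P x.
Proof.
move=> Pp PD; elim/Tensor_ind=> // r s.
rewrite -(part_sum r) -(part_sum s) tensDl !tensDr.
by apply: (PD); apply: (PD); apply: Pp; exact: homog_part.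
Qed.

Fact tens_partM b (x y : T) :
  part b (x * y) = part false x * part b y + part true x * part (~~ b) y.
Proof.
elim/Tensor_homog_ind: x y => [c d r s hr hs|x x' IH IH'] y; last first.
  by rewrite mulrDl !partD IH IH' !mulrDl addrACA.
elim/Tensor_homog_ind: y => [c' d' r' s' hr' hs'|y y' IH IH']; last first.
  by rewrite mulrDr !partD IH IH' !mulrDr addrACA.
have hx := homog_tens hr hs; have hy := homog_tens hr' hs'.
have hxy : homog ((c (+) d) (+) (c' (+) d')) (tens r s * tens r' s').
  have h : homog ((c (+) c') (+) (d (+) d')) (tens (r * r') (s * s')).
    by apply: homog_tens; exact: homogM.
  rewrite (tensM_homog _ _ hs hr') addbACA; case: ifP => // _; exact: homogN.
rewrite !(part_homog _ hx) !(part_homog _ hy) (part_homog _ hxy).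
move: (c (+) d) (c' (+) d') => e e'.
by case: e; case: e'; case: b; rewrite /= ?mul0r ?mulr0 ?addr0 ?add0r.
Qed.

Fact tens_homog1 : homog false (1 : T).
Proof. by have := homog_tens (@homog1 R) (@homog1 S). Qed.

Fact tens_homogM b c (x y : T) : homog b x -> homog c y -> homog (b (+) c) (x * y).
Proof.
move=> hx hy; apply/homogP; rewrite tens_partM !(part_homog _ hx) !(part_homog _ hy).
by case: b {hx}; case: c {hy}; rewrite /= ?mul0r ?mulr0 ?addr0 ?add0r.
Qed.

HB.instance Definition _ := isSuperRing.Build T tens_homog1 tens_homogM.

Fact tens_supermulC b c (x y : T) :
  homog b x -> homog c y -> x * y = (-1) ^+ (b && c) * (y * x).
Proof.
suff h (u v : T) : part b u * part c v =
    if b && c then - (part c v * part b u) else part c v * part b u.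
  move=> /homogP hx /homogP hy; have := h x y; rewrite hx hy => ->.
  by case: (b && c); rewrite ?mulN1r ?mul1r.
elim/Tensor_homog_ind: u v => [d e r s hr hs|x' x'' IH IH'] v; last first.
  by rewrite partD mulrDl mulrDr IH IH'; case: ifP; rewrite ?opprD.
elim/Tensor_homog_ind: v => [d' e' r' s' hr' hs'|v v' IH IH']; last first.
  by rewrite partD mulrDl mulrDr IH IH'; case: ifP; rewrite ?opprD.
rewrite !(part_homog _ (homog_tens hr hs)) !(part_homog _ (homog_tens hr' hs')).
case: eqP => [->|_]; last by rewrite mul0r mulr0 oppr0 if_same.
case: eqP => [->|_]; last by rewrite mul0r mulr0 oppr0 if_same.
rewrite (tensM_homog _ _ hs hr') (tensM_homog _ _ hs' hr).
rewrite (supermulC _ _ _ _ hr hr') (supermulC _ _ _ _ hs hs').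
case: d {hr}; case: e {hs}; case: d' {hr'}; case: e' {hs'};
  by rewrite /= ?mulN1r ?mul1r ?tensNl ?tensNr ?opprK.
Qed.

HB.instance Definition _ := isSuperCom.Build T tens_supermulC.

Lemma tens_scaleAl a (x y : T) : a *: (x * y) = (a *: x) * y.
Proof.
elim/Tensor_ind: x y => [r s|x x' IH IH'] y; last first.
  by rewrite mulrDl !scalerDr IH IH' mulrDl.
elim/Tensor_ind: y => [r' s'|y y' IH IH']; last by rewrite !mulrDr scalerDr IH IH'.
by rewrite tensZ !tensM scalerDr !tensZ !sym_scaleE !mulrA.
Qed.

End TensorAlgebra.

(* Sub-supermodules and quotients *)
Record subsupermod (A : superRingType) (M : superLmodType A) := SubSupermod {
  ssm_mem :> M -> Prop;
  ssm_0 : ssm_mem 0;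
  ssm_D : forall x y, ssm_mem x -> ssm_mem y -> ssm_mem (x + y);
  ssm_Z : forall a x, ssm_mem x -> ssm_mem (a *: x);
  ssm_part : forall b x, ssm_mem x -> ssm_mem (part b x)
}.

Section SubQuotient.
Variables (A : superRingType) (M : superLmodType A) (N : subsupermod M).

Lemma ssm_N x : N x -> N (- x).
Proof. by rewrite -scaleN1r; exact: ssm_Z. Qed.

Definition ssm_pred : pred M := fun x => `[< N x >].

Record elements : Type := Element { element_val :> M; _ : ssm_pred element_val }.

Fact ssm_pred_closed : subsemimod_closed ssm_pred.
Proof.
split; first split.
- exact/asboolP/ssm_0.
- by move=> x y /asboolP hx /asboolP hy; exact/asboolP/ssm_D.
- by move=> a x /asboolP hx; exact/asboolP/ssm_Z.
Qed.

HB.instance Definition _ := GRing.isSubSemiModClosed.Build A M ssm_pred ssm_pred_closed.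
HB.instance Definition _ := [isSub for element_val].
HB.instance Definition _ := [Choice of elements by <:].
HB.instance Definition _ := [SubChoice_isSubLmodule of elements by <:].

Lemma elementP (x : elements) : N x.
Proof. by case: x => x /= /asboolP. Qed.

Definition element_part b (x : elements) : elements :=
  Element (asboolT (ssm_part b (elementP x))).

Fact element_partD b : {morph element_part b : x y / x + y}.
Proof. by move=> x y; apply: val_inj; exact: partD. Qed.

Fact element_part_part b c x :
  element_part b (element_part c x) = if b == c then element_part c x else 0.
Proof. by apply: val_inj; rewrite /= part_part; case: eqP. Qed.

Fact element_part_sum x : element_part false x + element_part true x = x.
Proof. by apply: val_inj; exact: part_sum. Qed.

HB.instance Definition _ :=
  isSuper.Build elements element_partD element_part_part element_part_sum.

Fact element_homogZ b c (a : A) (x : elements) :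
  homog b a -> homog c x -> homog (b (+) c) (a *: x).
Proof.
move=> ha /homogP hx; apply/homogP/val_inj; apply/homogP/homogZ => //.
by apply/homogP; exact: (congr1 val hx).
Qed.

HB.instance Definition _ := isSuperLmodule.Build A elements element_homogZ.

Definition quo_rel : rel M := fun x y => `[< N (x - y) >].

Fact quo_rel_refl : reflexive quo_rel.
Proof. by move=> x; apply/asboolP; rewrite subrr; exact: ssm_0. Qed.

Fact quo_rel_sym : symmetric quo_rel.
Proof. by move=> x y; apply/asboolP/asboolP => /ssm_N; rewrite opprB. Qed.

Fact quo_rel_trans : transitive quo_rel.
Proof.
move=> y x z /asboolP xy /asboolP yz; apply/asboolP.
by rewrite -(subrK y x) -addrA; exact: ssm_D.
Qed.

Canonical quo_equiv := EquivRel quo_rel quo_rel_refl quo_rel_sym quo_rel_trans.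

Definition SuperQuot : Type := {eq_quot quo_equiv}.

HB.instance Definition _ := Choice.on SuperQuot.
HB.instance Definition _ : EqQuotient _ quo_equiv SuperQuot := EqQuotient.on SuperQuot.

Definition cls (x : M) : SuperQuot := \pi_SuperQuot x.

Lemma clsP x y : N (x - y) <-> cls x = cls y.
Proof. by split=> [h|/eqmodP/asboolP//]; apply/eqmodP/asboolP. Qed.

Lemma cls_surj (u : SuperQuot) : {x | u = cls x}.
Proof. by exists (repr u); rewrite /cls reprK. Qed.

Lemma cls_repr x : N (repr (cls x) - x).
Proof. by apply/clsP; rewrite /cls reprK. Qed.

Definition quo_add (u v : SuperQuot) := cls (repr u + repr v).
Definition quo_opp (u : SuperQuot) := cls (- repr u).
Definition quo_scale a (u : SuperQuot) := cls (a *: repr u).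
Definition quo_part b (u : SuperQuot) := cls (part b (repr u)).

Fact quo_addE x y : quo_add (cls x) (cls y) = cls (x + y).
Proof. by apply/clsP; rewrite opprD addrACA; apply: ssm_D; exact: cls_repr. Qed.

Fact quo_oppE x : quo_opp (cls x) = cls (- x).
Proof. by apply/clsP; rewrite -opprD; apply/ssm_N/cls_repr. Qed.

Fact quo_scaleE a x : quo_scale a (cls x) = cls (a *: x).
Proof. by apply/clsP; rewrite -scalerBr; apply/ssm_Z/cls_repr. Qed.

Fact quo_partE b x : quo_part b (cls x) = cls (part b x).
Proof. by apply/clsP; rewrite -partB; apply/ssm_part/cls_repr. Qed.

Fact quo_addA : associative quo_add.
Proof.
move=> u v w; have [x ->] := cls_surj u; have [y ->] := cls_surj v.
by have [z ->] := cls_surj w; rewrite !quo_addE addrA.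
Qed.

Fact quo_addC : commutative quo_add.
Proof.
move=> u v; have [x ->] := cls_surj u; have [y ->] := cls_surj v.
by rewrite !quo_addE addrC.
Qed.

Fact quo_add0 : left_id (cls 0) quo_add.
Proof. by move=> u; have [x ->] := cls_surj u; rewrite quo_addE add0r. Qed.

Fact quo_addN : left_inverse (cls 0) quo_opp quo_add.
Proof. by move=> u; have [x ->] := cls_surj u; rewrite quo_oppE quo_addE addNr. Qed.

HB.instance Definition _ := GRing.isZmodule.Build SuperQuot
  quo_addA quo_addC quo_add0 quo_addN.

Lemma clsD x y : cls (x + y) = cls x + cls y.
Proof. by rewrite -quo_addE. Qed.

Lemma cls0 : cls 0 = 0. Proof. by []. Qed.

Fact quo_scaleA a b u : quo_scale a (quo_scale b u) = quo_scale (a * b) u.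
Proof. by have [x ->] := cls_surj u; rewrite !quo_scaleE scalerA. Qed.

Fact quo_scale1 : left_id 1 quo_scale.
Proof. by move=> u; have [x ->] := cls_surj u; rewrite quo_scaleE scale1r. Qed.

Fact quo_scaleDr : right_distributive quo_scale +%R.
Proof.
move=> a u v; have [x ->] := cls_surj u; have [y ->] := cls_surj v.
by rewrite -clsD !quo_scaleE -clsD scalerDr.
Qed.

Fact quo_scaleDl u : {morph quo_scale^~ u : a b / a + b}.
Proof. by move=> a b; have [x ->] := cls_surj u; rewrite !quo_scaleE -clsD scalerDl. Qed.

HB.instance Definition _ :=
  GRing.Zmodule_isLmodule.Build A SuperQuot quo_scaleA quo_scale1 quo_scaleDr quo_scaleDl.

Fact quo_partD b : {morph quo_part b : x y / x + y}.
Proof.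
move=> u v; have [x ->] := cls_surj u; have [y ->] := cls_surj v.
by rewrite -clsD !quo_partE -clsD partD.
Qed.

Fact quo_part_part b c u : quo_part b (quo_part c u) = if b == c then quo_part c u else 0.
Proof.
by have [x ->] := cls_surj u; rewrite !quo_partE part_part; case: eqP => // _; rewrite cls0.
Qed.

Fact quo_part_sum u : quo_part false u + quo_part true u = u.
Proof. by have [x ->] := cls_surj u; rewrite !quo_partE -clsD part_sum. Qed.

HB.instance Definition _ := isSuper.Build SuperQuot quo_partD quo_part_part quo_part_sum.

Lemma clsZ a x : cls (a *: x) = a *: cls x.
Proof. by rewrite -quo_scaleE. Qed.

Lemma cls_part b x : cls (part b x) = part b (cls x).
Proof. by rewrite -quo_partE. Qed.

Fact quo_homogZ b c (a : A) (u : SuperQuot) :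
  homog b a -> homog c u -> homog (b (+) c) (a *: u).
Proof.
move=> ha /homogP hu; have [x ux] := cls_surj u.
have -> : u = cls (part c x) by rewrite cls_part -ux hu.
rewrite -clsZ; apply/homogP; rewrite -cls_part.
by have /homogP -> : homog (b (+) c) (a *: part c x) by apply: homogZ; last exact: homog_part.
Qed.

HB.instance Definition _ := isSuperLmodule.Build A SuperQuot quo_homogZ.

End SubQuotient.

Section Homology.
Variables (A : superRingType) (M : superLmodType A) (Z B : subsupermod M).

Fact restrict_ssm_0 : B (val (0 : elements Z)). Proof. exact: ssm_0. Qed.
Fact restrict_ssm_D (x y : elements Z) : B (val x) -> B (val y) -> B (val (x + y)).
Proof. exact: ssm_D. Qed.
Fact restrict_ssm_Z a (x : elements Z) : B (val x) -> B (val (a *: x)).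
Proof. exact: ssm_Z. Qed.
Fact restrict_ssm_part b (x : elements Z) : B (val x) -> B (val (part b x)).
Proof. exact: ssm_part. Qed.

Definition restrict_ssm : subsupermod (elements Z) :=
  @SubSupermod A (elements Z) (fun x => B (val x)) restrict_ssm_0 restrict_ssm_D restrict_ssm_Z restrict_ssm_part.

(* Z / B, for B contained in Z *)
Definition homology : Type := SuperQuot restrict_ssm.

HB.instance Definition _ := SuperLmodule.on homology.

End Homology.

(* Isomorphism of supermodules: an even A-linear bijection. *)
Definition super_iso (A : superRingType) (M N : superLmodType A) : Prop :=
  exists f : {linear M -> N},
    bijective f /\ forall b (x : M), homog b x -> homog b (f x).

(* The dual super Koszul complex of V = A^(p|q) *)
Section Koszul.
Variables (A : superComRingType) (p q : nat).

Local Notation V := (sfree A p q).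

(* The dual basis of Pi V.  The coordinates of v in V are its left coordinates;
   a functional that is linear on the right reads off the right coordinates,
   which differ by a sign at the odd vectors theta_j. *)
Definition coord_fun (s : 'I_p + 'I_q) : Pi V -> A^o :=
  fun v => let a := of_Pi v s in if is_odd_index s then bar (a : A) else a.

Fact pi_rscaleE (m : Pi V) a : of_Pi (rscale m a) = rscale (of_Pi m) a.
Proof.
rewrite /rscale; congr (_ + _); last first.
  have -> : bar m = to_Pi (- bar (of_Pi m)) by rewrite /bar opprB.
  rewrite [LHS](_ : _ = bar (part true a) *: - bar (of_Pi m)) //.
  by rewrite (bar_homog (homog_part _ _)) scaleNr scalerN opprK.
rewrite [LHS](_ : _ = bar (part false a) *: of_Pi m) //.
by rewrite (bar_homog (homog_part _ _)).
Qed.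

Lemma barN (U : superZmodType) (x : U) : bar (- x) = - bar x.
Proof. by rewrite /bar !partN opprD. Qed.

Fact bar_free (v : V) s : bar v s = if is_odd_index s then - bar (v s) else bar (v s).
Proof.
by rewrite /bar !ffunE; case: (is_odd_index s); rewrite //= opprB.
Qed.

Fact coord_fun_rlinear s : rlin_pred (coord_fun s).
Proof.
apply/asboolP; split=> [m n|m a].
  have e : of_Pi (m + n) = of_Pi m + of_Pi n by [].
  by rewrite /coord_fun e ffunE /= barD; case: ifP.
rewrite /coord_fun pi_rscaleE.
have -> : rscale (of_Pi m) a s =
    part false a * (of_Pi m s : A) + part true a * (bar (of_Pi m) s : A).
  by rewrite /rscale !ffunE.
rewrite bar_free; case: (is_odd_index s); last by rewrite [RHS]supermulE.
rewrite [RHS]supermulE barK; move: (of_Pi m s : A) => x.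
rewrite barD !barM (bar_homog (homog_part false a)) (bar_homog (homog_part true a)).
by rewrite barN barK mulrNN.
Qed.

Definition dual_basis (s : 'I_p + 'I_q) : dual (Pi V) := Dual (coord_fun_rlinear s).

Lemma dual_basisE s t : dual_basis s (to_Pi (svec A t)) = (s == t)%:R.
Proof.
rewrite /= /coord_fun /= ffunE; case: ifP => // _.
by case: eqP => _; rewrite ?bar0 ?(bar_homog homog1).
Qed.

Lemma homog_svec s : homog (is_odd_index s) (svec A s : V).
Proof.
apply/homogP/ffunP=> t; rewrite !ffunE; case: eqP => [->|_].
  by rewrite addbb (part_homog _ homog1).
exact: part0.
Qed.

Lemma homog_dual_basis s : homog (~~ is_odd_index s) (dual_basis s).
Proof.
apply/homogP/dualP=> m; rewrite /= /dpart /= /coord_fun.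
have e c : of_Pi (part c m) s = part (~~ c (+) is_odd_index s) (of_Pi m s).
  by rewrite [LHS]ffunE.
rewrite !e negbK /=; case: (is_odd_index s) => /=; move: (of_Pi m s : A) => a.
  by rewrite !part_bar !part_part.
by rewrite !part_part /= addrC part_sum.
Qed.

Definition xvec (i : 'I_p) : V := svec A (inl i).
Definition thetavec (j : 'I_q) : V := svec A (inr j).
Definition dchi (i : 'I_p) : dual (Pi V) := dual_basis (inl i).
Definition dell (j : 'I_q) : dual (Pi V) := dual_basis (inr j).

Definition koszul_dual : Type := Tensor (Sym V) (Sym (dual (Pi V))).

HB.instance Definition _ := SuperLmodule.on koszul_dual.
HB.instance Definition _ := SuperComRing.on koszul_dual.

Local Notation K := koszul_dual.

Definition koszul_elt : K :=
  \sum_(i < p) tens (sym_gen (xvec i)) (sym_gen (dchi i)) +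
  \sum_(j < q) tens (sym_gen (thetavec j)) (sym_gen (dell j)).

Definition delta (z : K) : K := koszul_elt * z.

Lemma homog_koszul_elt : homog true koszul_elt.
Proof.
apply: homogD; apply: homog_sum => i _.
  apply: (@homog_tens _ _ _ false true); apply: homog_gen.
    exact: (homog_svec (inl i)).
  exact: (homog_dual_basis (inl i)).
apply: (@homog_tens _ _ _ true false); apply: homog_gen.
  exact: (homog_svec (inr i)).
exact: (homog_dual_basis (inr i)).
Qed.

Lemma delta0 : delta 0 = 0. Proof. exact: mulr0. Qed.

Lemma deltaD : {morph delta : x y / x + y}. Proof. exact: mulrDr. Qed.

Lemma delta_part b z : part b (delta z) = delta (part (~~ b) z).
Proof.
by rewrite /delta partM !(part_homog _ homog_koszul_elt) /= mul0r add0r.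
Qed.

Lemma deltaZ a z : delta (a *: z) = bar a *: delta z.
Proof.
pose sc (c : A) : K := c *: (1 : K).
have scaleE (c : A) (x : K) : c *: x = sc c * x.
  by rewrite -[x in LHS]mul1r [LHS]tens_scaleAl.
have part_sc b : part b (sc a) = sc (part b a).
  rewrite /sc partZ !(part_homog _ homog1).
  by case: b; rewrite /= scaler0 ?addr0 ?add0r.
rewrite /delta scaleE mulrA (supermulE koszul_elt) (bar_homog homog_koszul_elt).
rewrite !part_sc mulrN -mulrBl [RHS]scaleE mulrA; congr (_ * _ * _).
by rewrite /sc -scalerBl.
Qed.

(* K^*_i = Sym V (x)_A Sym^i (Pi V)^* *)
Definition koszul_deg (i : nat) : K -> Prop :=
  sums_of (fun z => exists r s, sympow i s /\ z = tens r s).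

Fact koszul_deg0 i : koszul_deg i 0. Proof. exact: sums_of0. Qed.

Fact koszul_degD i x y : koszul_deg i x -> koszul_deg i y -> koszul_deg i (x + y).
Proof. exact: sums_ofD. Qed.

Fact koszul_degZ i a x : koszul_deg i x -> koszul_deg i (a *: x).
Proof.
move=> hx; apply: (sums_of_map (f := fun y : K => a *: y)) hx => [||y].
- exact: scaler0.
- exact: scalerDr.
by case=> r [s [hs ->]]; apply: sums_of1; exists (a *: r), s; rewrite -tensZ.
Qed.

Fact koszul_deg_part i b x : koszul_deg i x -> koszul_deg i (part b x).
Proof.
move=> hx; apply: (sums_of_map (f := part b)) hx => [||y].
- exact: part0.
- exact: partD.
case=> r [s [hs ->]]; rewrite [part b _]part_tens.
by apply: sums_ofD; apply: sums_of1;
   [exists (part false r), (part b s) | exists (part true r), (part (~~ b) s)];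
   split=> //; exact: sympow_part.
Qed.

Definition cocycle i (z : K) : Prop := koszul_deg i z /\ delta z = 0.

Definition coboundary i (z : K) : Prop :=
  if i is j.+1 then exists2 y, koszul_deg j y & z = delta y else z = 0.

Fact cocycle0 i : cocycle i 0.
Proof. by split; [exact: koszul_deg0 | exact: delta0]. Qed.

Fact cocycleD i x y : cocycle i x -> cocycle i y -> cocycle i (x + y).
Proof.
by case=> hx dx [hy dy]; split; [exact: koszul_degD | rewrite deltaD dx dy addr0].
Qed.

Fact cocycleZ i a x : cocycle i x -> cocycle i (a *: x).
Proof. by case=> hx dx; split; [exact: koszul_degZ | rewrite deltaZ dx scaler0]. Qed.

Fact cocycle_part i b x : cocycle i x -> cocycle i (part b x).
Proof.
case=> hx dx; split; first exact: koszul_deg_part.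
by rewrite -[b]negbK -delta_part dx part0.
Qed.

Definition cocycles i : subsupermod K :=
  @SubSupermod A K (cocycle i) (cocycle0 i) (@cocycleD i) (@cocycleZ i) (@cocycle_part i).

Fact coboundary0 i : coboundary i 0.
Proof. by case: i => //= i; exists 0; [exact: koszul_deg0 | rewrite delta0]. Qed.

Fact coboundaryD i x y : coboundary i x -> coboundary i y -> coboundary i (x + y).
Proof.
case: i => [-> ->|i [u hu ->] [v hv ->]] /=; first by rewrite addr0.
by exists (u + v); [exact: koszul_degD | rewrite deltaD].
Qed.

Fact coboundaryZ i a x : coboundary i x -> coboundary i (a *: x).
Proof.
case: i => [->|i [u hu ->]] /=; first exact: scaler0.
by exists (bar a *: u); [exact: koszul_degZ | rewrite deltaZ barK].
Qed.

Fact coboundary_part i b x : coboundary i x -> coboundary i (part b x).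
Proof.
case: i => [->|i [u hu ->]] /=; first exact: part0.
by exists (part (~~ b) u); [exact: koszul_deg_part | rewrite delta_part].
Qed.

Definition coboundaries i : subsupermod K :=
  @SubSupermod A K (coboundary i) (coboundary0 i) (@coboundaryD i) (@coboundaryZ i)
    (@coboundary_part i).

(* Ext^i_R(A, R), for R = Sym V *)
Definition Ext (i : nat) : Type := homology (cocycles i) (coboundaries i).

HB.instance Definition _ i := SuperLmodule.on (Ext i).

Definition Ext_class i (z : elements (cocycles i)) : Ext i :=
  cls (restrict_ssm (cocycles i) (coboundaries i)) z.

(* theta_1 ... theta_q (x) d_chi_1 ... d_chi_p *)
Definition top_elt : K :=
  tens (\prod_(j < q) sym_gen (thetavec j)) (\prod_(i < p) sym_gen (dchi i)).

End Koszul.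

(* Main.v *)
From HB Require Import structures.
Require Import Defs.
From mathcomp Require Import all_boot all_order all_algebra.
From mathcomp Require Import boolp zify.

(* As an A-algebra the dual Koszul complex is free on the even generators e_s
   (the x_i and the d_ell_j) and the odd generators o_s (the d_chi_i and the
   theta_j), with s ranging over the p + q basis vectors of V, and its
   differential is multiplication by D = sum_s e_s o_s.  The second order operator
   h = sum_s d/de_s d/do_s satisfies
     h D + D h = sum_s (1 + e_s d/de_s - o_s d/do_s),
   which multiplies the monomial e^k o^f by its weight sum_s (k_s + 1 - f_s), a
   natural number that vanishes only on the product of all the o_s.  On a cocycle z
   of weight at most N + 1, (N + 1) z - D h z has weight at most N, so in
   characteristic 0 induction on N shows that z is cohomologous to a multiple of
   top_elt.  Conversely a top_elt = D y forces a = 0: apply all the d/do_s, and then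
   the augmentation that kills the generators. *)

Set Implicit Arguments.
Unset Strict Implicit.
Unset Printing Implicit Defensive.

Import GRing.Theory.
Local Open Scope ring_scope.

(** * Superderivations of a supersymmetric algebra *)

(** The Koszul sign that an operator of parity [b] picks up when it moves past [x]. *)
Definition sbar (V : superZmodType) (b : bool) (x : V) : V := if b then bar x else x.

Section SignTwist.
Variable V : superZmodType.
Implicit Types (x y : V) (b c : bool).

Lemma sbarD b x y : sbar b (x + y) = sbar b x + sbar b y.
Proof. by case: b; rewrite /= ?barD. Qed.

Lemma sbar0 b : sbar b (0 : V) = 0.
Proof. by case: b; rewrite /= ?bar0. Qed.

Lemma sbarN b x : sbar b (- x) = - sbar b x.
Proof. by case: b; rewrite /= ?barN. Qed.

Lemma sbarC b c x : sbar b (sbar c x) = sbar c (sbar b x).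
Proof. by case: b; case: c. Qed.

Lemma sbar_homog b c x : homog c x -> sbar b x = if b && c then - x else x.
Proof. by move=> hx; case: b; rewrite //= (bar_homog hx). Qed.

End SignTwist.

Lemma sbarM (R : superRingType) b (x y : R) : sbar b (x * y) = sbar b x * sbar b y.
Proof. by case: b; rewrite /= ?barM. Qed.

Lemma sbarZ (A : superRingType) (M : superLmodType A) b a (m : M) :
  sbar b (a *: m) = sbar b a *: sbar b m.
Proof. by case: b; rewrite /= ?barZ. Qed.

Section SymExtra.
Variables (A : superComRingType) (M : superLmodType A).

Lemma sym_cstN a : sym_cst M (- a) = - sym_cst M a.
Proof. by apply/eqP; rewrite -addr_eq0 -sym_cstD addNr sym_cst0. Qed.

Lemma sym_genN (m : M) : sym_gen (- m) = - sym_gen m.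
Proof. by apply/eqP; rewrite -addr_eq0 -sym_genD addNr sym_gen0. Qed.

Lemma sbar_cst b a : sbar b (sym_cst M a) = sym_cst M (sbar b a).
Proof. by case: b; rewrite //= bar_cst. Qed.

Lemma sbar_gen b (m : M) : sbar b (sym_gen m) = sym_gen (sbar b m).
Proof. by case: b; rewrite //= /bar !part_gen sym_genD sym_genN. Qed.

Lemma supermul_sign (R : superComRingType) b c (x y : R) :
  homog b x -> homog c y -> x * y = if b && c then - (y * x) else y * x.
Proof.
by move=> hx hy; rewrite (supermulC _ _ _ _ hx hy); case: ifP; rewrite ?mulN1r ?mul1r.
Qed.

(** The augmentation of [Sym M], with kernel generated by [M]. It is computed on expressions and
    descends to the quotient because it respects every defining relation. *)
Fixpoint aug_term (t : sym_term A M) : A :=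
  match t with
  | SCst a => a
  | SGen m => 0
  | SAdd s t => aug_term s + aug_term t
  | SOpp s => - aug_term s
  | SMul s t => aug_term s * aug_term t
  end.

Lemma aug_term_eqv s t : sym_eqv s t -> aug_term s = aug_term t.
Proof.
elim=> {s t} //=.
- by move=> s t u _ -> _ ->.
- by move=> s s' t t' _ -> _ ->.
- by move=> s s' _ ->.
- by move=> s s' t t' _ -> _ ->.
- by move=> s t u; rewrite addrA.
- by move=> s t; rewrite addrC.
- by move=> t; rewrite add0r.
- by move=> t; rewrite addNr.
- by move=> s t u; rewrite mulrA.
- by move=> t; rewrite mul1r.
- by move=> t; rewrite mulr1.
- by move=> s t u; rewrite mulrDl.
- by move=> s t u; rewrite mulrDr.
- by rewrite addr0.
- by move=> a _; rewrite mulr0.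
- by move=> b c a m _ _; case: (b && c); rewrite /= mulr0 mul0r ?oppr0.
- by move=> b c m n _ _; case: (b && c); rewrite /= mulr0 ?oppr0.
Qed.

Definition aug (x : Sym M) : A := aug_term (repr x).

Lemma aug_pi t : aug (sym_pi t) = aug_term t.
Proof. exact/aug_term_eqv/sym_repr. Qed.

Lemma aug_cst a : aug (sym_cst M a) = a. Proof. exact: aug_pi. Qed.

Lemma aug_gen (m : M) : aug (sym_gen m) = 0. Proof. exact: aug_pi. Qed.

Lemma augD x y : aug (x + y) = aug x + aug y.
Proof.
have [s ->] := sym_pi_surj x; have [t ->] := sym_pi_surj y.
by rewrite -sym_piD !aug_pi.
Qed.

Lemma augM x y : aug (x * y) = aug x * aug y.
Proof.
have [s ->] := sym_pi_surj x; have [t ->] := sym_pi_surj y.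
by rewrite -sym_piM !aug_pi.
Qed.

End SymExtra.

Section Derivation.
Variables (A : superComRingType) (M : superLmodType A) (b : bool) (phi : M -> A).

(** Linear forms of parity [b] in left-hand notation: a scalar pulled out to the left crosses [phi],
    whence the sign. These are the forms that extend to superderivations. *)
Definition super_form : Prop :=
  [/\ {morph phi : m n / m + n},
      forall a m, phi (a *: m) = sbar b a * phi m &
      forall c m, homog c m -> homog (b (+) c) (phi m)].

(** The superderivation of parity [b] that kills [A] and restricts to [phi] on [M], defined on
    expressions by the signed Leibniz rule. *)
Fixpoint der_term (t : sym_term A M) : Sym M :=
  match t with
  | SCst a => 0
  | SGen m => sym_cst M (phi m)
  | SAdd s t => der_term s + der_term t
  | SOpp s => - der_term s
  | SMul s t => der_term s * sym_pi t + sbar b (sym_pi s) * der_term t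
  end.

Definition der (x : Sym M) : Sym M := der_term (repr x).

Hypothesis phiS : super_form.

(** Only the two supercommutation relations use the parity of [phi m]; each comes down to a sign
    check over the eight values of three parities. *)
Lemma der_term_eqv s t : sym_eqv s t -> der_term s = der_term t.
Proof.
case: phiS => phiD phiZ phi_homog.
elim=> {s t} //=.
- by move=> s t u _ -> _ ->.
- by move=> s s' t t' _ -> _ ->.
- by move=> s s' _ ->.
- by move=> s s' t t' /sym_piP-> -> /sym_piP-> ->.
- by move=> s t u; rewrite addrA.
- by move=> s t; rewrite addrC.
- by move=> t; rewrite add0r.
- by move=> t; rewrite addNr.
- by move=> s t u; rewrite !sym_piM sbarM mulrDl mulrDr !mulrA addrA.
- move=> t; rewrite -[sym_pi (SCst 1)]/(sym_cst M 1) sbar_cst.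
  by rewrite (sbar_homog _ homog1) andbF mul0r add0r sym_cst1 mul1r.
- by move=> t; rewrite -[sym_pi (SCst 1)]/(sym_cst M 1) sym_cst1 mulr1 mulr0 addr0.
- by move=> s t u; rewrite !sym_piD sbarD !mulrDl addrACA.
- by move=> s t u; rewrite !sym_piD !mulrDr addrACA.
- by rewrite addr0.
- by move=> a c; rewrite mul0r mulr0 addr0.
- by move=> m n; rewrite phiD sym_cstD.
- move=> a m; rewrite phiZ sym_cstM mul0r add0r.
  by rewrite -[sym_pi (SCst a)]/(sym_cst M a) sbar_cst.
- move=> c d a m ha hm; rewrite mulr0 addr0 -[sym_pi (SCst a)]/(sym_cst M a).
  have -> : der_term (sopp_if (c && d) (SMul (SCst a) (SGen m))) =
     if c && d then - (sym_cst M (sbar b a * phi m)) else sym_cst M (sbar b a * phi m).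
    case: (c && d); rewrite /= mul0r add0r -[sym_pi (SCst a)]/(sym_cst M a);
      by rewrite sbar_cst sym_cstM.
  rewrite -sym_cstM (supermul_sign (phi_homog _ _ hm) ha) (sbar_homog b ha).
  clear ha hm; move: (b) c d => [] [] []; rewrite /= ?mulNr ?sym_cstN ?opprK //.
- move=> c d m n hm hn; rewrite -![sym_pi (SGen _)]/(sym_gen _).
  have -> : der_term (sopp_if (c && d) (SMul (SGen n) (SGen m))) =
     let x := sym_cst M (phi n) * sym_gen m + sbar b (sym_gen n) * sym_cst M (phi m) in
     if c && d then - x else x.
    by case: (c && d).
  rewrite /= !sbar_gen !(sbar_homog b hm) !(sbar_homog b hn).
  have em := supermul_sign (homog_cst M (phi_homog _ _ hm)) (homog_gen hn).
  have en := supermul_sign (homog_cst M (phi_homog _ _ hn)) (homog_gen hm).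
  rewrite em en; clear em en hm hn; move: (b) c d => [] [] []; rewrite /= ?sym_genN ?mulNr ?opprD ?opprK addrC //.
Qed.

Lemma der_pi t : der (sym_pi t) = der_term t.
Proof. exact/der_term_eqv/sym_repr. Qed.

Lemma der_cst a : der (sym_cst M a) = 0. Proof. exact: der_pi. Qed.

Lemma der_gen m : der (sym_gen m) = sym_cst M (phi m). Proof. exact: der_pi. Qed.

Lemma derD x y : der (x + y) = der x + der y.
Proof.
have [s ->] := sym_pi_surj x; have [t ->] := sym_pi_surj y.
by rewrite -sym_piD !der_pi.
Qed.

Lemma derN x : der (- x) = - der x.
Proof. by have [s ->] := sym_pi_surj x; rewrite -sym_piN !der_pi. Qed.

Lemma derM x y : der (x * y) = der x * y + sbar b x * der y.
Proof.
have [s ->] := sym_pi_surj x; have [t ->] := sym_pi_surj y.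
by rewrite -sym_piM !der_pi.
Qed.

Lemma der0 : der 0 = 0. Proof. exact: der_cst. Qed.

Lemma der1 : der 1 = 0. Proof. exact: der_cst. Qed.

Lemma derZ a x : der (a *: x) = sbar b a *: der x.
Proof. by rewrite !sym_scaleE derM der_cst mul0r add0r sbar_cst. Qed.

Lemma der_rscale x a : der (rscale x a) = rscale (der x) a.
Proof. by rewrite !sym_rscaleE derM der_cst mulr0 addr0. Qed.

(** A derivation of parity [b] shifts parities by [b], so it commutes with the parity involution up
    to the sign (-1)^b. Checking this on homogeneous generators is enough. *)
Lemma der_sbar c x : der (sbar c x) = if b && c then - sbar c (der x) else sbar c (der x).
Proof.
case: c; last by rewrite andbF.
rewrite andbT; case: phiS => phiD phiZ phi_homog.
elim/Sym_ind: x => [a|m|x y IHx IHy|x IHx|x y IHx IHy].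
- by rewrite sbar_cst !der_cst sbar0 oppr0 if_same.
- elim/super_ind: m => [m n IHm IHn|c m hm].
    rewrite sym_genD sbarD (derD (sbar _ _)) (derD (sym_gen m)) IHm IHn sbarD; case: ifP => // _.
    by rewrite -opprD.
  rewrite sbar_gen (sbar_homog _ hm) [in RHS]der_gen sbar_cst.
  rewrite (sbar_homog _ (phi_homog _ _ hm)).
  clear hm; case: c; case: (b); by rewrite /= ?sym_genN ?derN der_gen ?sym_cstN ?opprK.
- rewrite sbarD (derD (sbar _ _)) (derD x) IHx IHy sbarD;
  by case: ifP => // _; rewrite -opprD.
- by rewrite sbarN !derN IHx sbarN; case: ifP.
- rewrite sbarM (derM (sbar _ _)) (derM x) IHx IHy (sbarD _ (der x * y)) !sbarM (sbarC b true).
  by case: (b); rewrite -?opprD ?mulNr ?mulrN -?opprD.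
Qed.

Lemma der_sympow0 x : sympow 0 x -> der x = 0.
Proof.
elim=> [|u v [a [t ->]] _ IH]; first exact: der0.
by rewrite derD IH tuple0 big_nil derZ der1 scaler0 addr0.
Qed.

(** In the Leibniz rule the first term trades a generator for a scalar, and the second keeps that
    generator and differentiates a shorter product. *)
Lemma der_sympow i x : sympow i.+1 x -> sympow i (der x).
Proof.
move=> hx; apply: (sums_of_map (f := der)) hx => [||y]; [exact: der0|exact: derD|].
case=> a [t ->]; rewrite derZ; apply: sympowZ.
move: (tval t) (size_tuple t) => {t} s; elim: s i => [//|m s IH] i [<-] {i}.
rewrite big_cons derM; apply: sums_ofD.
  rewrite der_gen -sym_scaleE; exact: sympow_seq.
(* For a single generator the induction hypothesis is vacuous; the remaining factor is 1, whose
   derivative vanishes. *)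
rewrite sbar_gen; case: s IH => [_|n s IH].
  rewrite big_nil der1 mulr0; exact: sums_of0.
by apply: sympow_gen; exact: IH.
Qed.

End Derivation.

(** * The Koszul homotopy *)

(* Left multiplications and partial derivatives: [sc] is the structure map of the
   A-algebra K, [ev s] and [od s] are the even and odd generators, [dev s] and
   [dod s] the derivatives along them. *)
Record superWeyl (A : superComRingType) (I : finType) (K : pzRingType) := SuperWeyl {
  sc : A -> K;
  ev : I -> K;
  od : I -> K;
  dev : I -> K -> K;
  dod : I -> K -> K;
  scD : {morph sc : a b / a + b};
  scM : {morph sc : a b / a * b};
  sc1 : sc 1 = 1;
  sc_inv : forall n, exists c, sc c *+ n.+1 = 1;
  evC : forall s z, ev s * z = z * ev s;
  odC : forall s t, od s * od t = - (od t * od s);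
  od_sq : forall s, od s * od s = 0;
  od_sc : forall s a, od s * sc a = sc (bar a) * od s;
  devD : forall s, {morph dev s : y z / y + z};
  dodD : forall s, {morph dod s : y z / y + z};
  dev1 : forall s, dev s 1 = 0;
  dod1 : forall s, dod s 1 = 0;
  dev_sc : forall s a z, dev s (sc a * z) = sc a * dev s z;
  dod_sc : forall s a z, dod s (sc a * z) = sc (bar a) * dod s z;
  dev_ev : forall s t z, dev s (ev t * z) = (if s == t then z else 0) + ev t * dev s z;
  dev_od : forall s t z, dev s (od t * z) = od t * dev s z;
  dod_ev : forall s t z, dod s (ev t * z) = ev t * dod s z;
  dod_od : forall s t z, dod s (od t * z) = (if s == t then z else 0) - od t * dod s z
}.

Section KoszulHomotopy.
Variables (A : superComRingType) (I : finType) (K : pzRingType) (W : superWeyl A I K).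

Local Notation sc := (sc W).
Local Notation e := (ev W).
Local Notation o := (od W).
Local Notation E := (dev W).
Local Notation O := (dod W).

Lemma sc0 : sc 0 = 0.
Proof. by apply: (addrI (sc 0)); rewrite -scD !addr0. Qed.

Lemma dev0 s : E s 0 = 0.
Proof. by apply: (addrI (E s 0)); rewrite -devD !addr0. Qed.

Lemma dod0 s : O s 0 = 0.
Proof. by apply: (addrI (O s 0)); rewrite -dodD !addr0. Qed.

Lemma devN s z : E s (- z) = - E s z.
Proof. by apply/eqP; rewrite -addr_eq0 -devD addNr dev0. Qed.

Definition kelt : K := \sum_s e s * o s.

Definition homotopy (z : K) : K := \sum_s E s (O s z).

Definition number_op (z : K) : K := \sum_s (z + e s * E s z - o s * O s z).

Lemma homotopyD : {morph homotopy : y z / y + z}.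
Proof.
by move=> y z; rewrite -big_split; apply: eq_bigr => s _; rewrite dodD devD.
Qed.

Lemma homotopy0 : homotopy 0 = 0.
Proof. by apply: big1 => s _; rewrite dod0 dev0. Qed.

Lemma number_opD : {morph number_op : y z / y + z}.
Proof.
move=> y z; rewrite -big_split; apply: eq_bigr => s _ /=.
by rewrite dodD devD !mulrDr opprD (addrACA y z) [LHS]addrACA.
Qed.

Lemma number_op0 : number_op 0 = 0.
Proof. by apply: big1 => s _; rewrite dod0 dev0 !mulr0 !addr0 subrr. Qed.

(** Pushing d/de_s d/do_s through e_t o_t changes its sign and, for t = s only, leaves the
    correction [w]. The sign-changed terms cancel against [kelt * homotopy z]. *)
Lemma homotopy_kelt z : homotopy (kelt * z) + kelt * homotopy z = number_op z.
Proof.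
rewrite mulr_sumr -big_split; apply: eq_bigr => s _ /=.
set w := z + _ - _.
have step t : E s (O s (e t * o t * z)) =
    (if s == t then w else 0) - e t * o t * E s (O s z).
  rewrite -mulrA dod_ev dod_od mulrBr devD devN -!(mulrA (e t)).
  rewrite !dev_ev dev_od; case: eqP => [<-|_]; last first.
    by rewrite dev0 mulr0 !add0r.
  by rewrite /w opprD !addrA; congr (_ - _); rewrite addrAC.
have addE (P : pred I) (F : I -> K) : E s (O s (\sum_(t | P t) F t)) = \sum_(t | P t) E s (O s (F t)).
  apply: (big_morph (fun x => E s (O s x))) => [x y|]; first by rewrite dodD devD.
  by rewrite dod0 dev0.
rewrite /kelt mulr_suml addE (eq_bigr _ (fun t _ => step t)) big_split /=.
rewrite -big_mkcond (eq_bigl (pred1 s)) ?big_pred1_eq; last by move=> t; rewrite /= eq_sym.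
by rewrite mulr_suml sumrN addrNK.
Qed.


(** * Monomials as eigenvectors of [number_op] *)

Lemma evCA t x z : x * (e t * z) = e t * (x * z).
Proof. by rewrite mulrA -evC mulrA. Qed.

Lemma odCA s t z : o s * (o t * z) = - (o t * (o s * z)).
Proof. by rewrite mulrA odC mulNr mulrA. Qed.

(** A ladder relation: [e t] raises eigenvalues by 1, because its commutator with e_s d/de_s is
    [e t] for s = t and 0 otherwise. *)
Lemma number_op_ev t z : number_op (e t * z) = e t * (number_op z + z).
Proof.
have step s : e t * z + e s * E s (e t * z) - o s * O s (e t * z) =
    e t * (z + e s * E s z - o s * O s z) + (if s == t then e t * z else 0).
  rewrite dev_ev dod_ev !mulrDr mulrN (evCA t (e s)) (evCA t (o s)); case: eqP => [->|_].
    by rewrite [X in _ + X - _]addrC addrA [LHS]addrAC.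
  by rewrite mulr0 add0r addr0.
rewrite /number_op (eq_bigr _ (fun s _ => step s)) big_split /= -mulr_sumr.
by rewrite -big_mkcond big_pred1_eq mulrDr.
Qed.

(** The opposite ladder relation: o_s d/do_s enters [number_op] with a minus sign, so [o t] lowers
    eigenvalues by 1. *)
Lemma number_op_od t z : number_op (o t * z) = o t * (number_op z - z).
Proof.
have step s : o t * z + e s * E s (o t * z) - o s * O s (o t * z) =
    o t * (z + e s * E s z - o s * O s z) - (if s == t then o t * z else 0).
  rewrite dev_od dod_od !mulrDr !mulrN -evCA odCA opprK opprD; case: eqP => [->|_].
    by rewrite addrA addrAC.
  by rewrite mulr0 subr0 oppr0 add0r.
rewrite /number_op (eq_bigr _ (fun s _ => step s)) big_split /= -mulr_sumr sumrN.
by rewrite -big_mkcond big_pred1_eq mulrBr.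
Qed.

Lemma number_op_sc a z : number_op (sc a * z) = sc a * number_op z.
Proof.
rewrite /number_op mulr_sumr; apply: eq_bigr => s _.
rewrite dev_sc dod_sc mulrBr mulrDr -evCA; congr (_ + _ - _).
by rewrite mulrA od_sc barK mulrA.
Qed.

Lemma number_op1 : number_op 1 = #|I|%:R.
Proof.
rewrite /number_op (eq_bigr (fun=> 1)) ?sumr_const // => s _.
by rewrite dev1 dod1 !mulr0 addr0 subr0.
Qed.

(** The list fixes the order of the factors, which matters for the anticommuting [o s]. Their
    exponents are booleans because [o s] squares to zero. *)
Definition monomial (k : I -> nat) (f : I -> bool) (r : seq I) : K :=
  \prod_(s <- r) (e s ^+ k s * o s ^+ f s).

(** The eigenvalue is taken in the integers because each odd factor subtracts 1. Over a list of all
    indices without repetition it becomes the natural number [weight k f]. *)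
Lemma number_op_monomial k f r :
  number_op (monomial k f r) =
  monomial k f r *~ (#|I|%:Z + \sum_(s <- r) ((k s)%:Z - (f s)%:Z)).
Proof.
rewrite /monomial; elim: r => [|s r IH].
  by rewrite !big_nil number_op1 addr0.
rewrite !big_cons addrCA; move: (_ + _) IH => c; move: (\prod_(_ <- _) _) => z IH.
have {}IH : number_op (o s ^+ f s * z) = o s ^+ f s * z *~ (c - (f s)%:Z).
  case: (f s); last by rewrite !mul1r subr0.
  by rewrite number_op_od IH mulrzBr mulrBr mulrzAr.
rewrite -!mulrA; elim: (k s) => [|n IHn]; first by rewrite !mul1r IH addrC sub0r.
rewrite exprS -!mulrA number_op_ev IHn -[in RHS]mulrzAr; congr (_ * _).
by rewrite -[X in _ + X]mulr1z -mulrzDr; congr (_ *~ _); lia.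
Qed.


Lemma monomial_eq k k' f f' (r : seq I) : {in r, k =1 k'} -> {in r, f =1 f'} ->
  monomial k f r = monomial k' f' r.
Proof.
by move=> hk hf; rewrite /monomial !big_seq; apply: eq_bigr => s hs; rewrite hk ?hf.
Qed.

Lemma monomial_cons k f s (r : seq I) :
  monomial k f (s :: r) = e s ^+ k s * (o s ^+ f s * monomial k f r).
Proof. by rewrite /monomial big_cons mulrA. Qed.

Lemma evXCA t n x z : x * (e t ^+ n * z) = e t ^+ n * (x * z).
Proof. by elim: n => [|n IH]; rewrite ?mul1r // exprS -!mulrA evCA IH. Qed.

Lemma od_exp t s (b : bool) z :
  o t * (o s ^+ b * z) = (-1) ^+ b * (o s ^+ b * (o t * z)).
Proof. by case: b; rewrite /= ?mul1r // !expr1 odCA mulN1r. Qed.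

Lemma ev_monomial t k f r : uniq r -> t \in r ->
  e t * monomial k f r = monomial (fun s => k s + (s == t))%N f r.
Proof.
elim: r => //= s r IH /andP[sr ur]; rewrite in_cons !monomial_cons.
case: eqP => [-> _|/nesym/eqP st /= tr].
  rewrite eqxx addn1 exprS -mulrA; congr (_ * (_ * (_ * _))); apply: monomial_eq => // u ur' /=.
  by case: eqP => [us|_]; [rewrite -us ur' in sr|rewrite addn0].
by rewrite (negPf st) addn0 -IH // evXCA -(evCA t (o s ^+ f s)).
Qed.

(** Moving [o t] to its place in the order costs a sign for each odd factor crossed. The sign stays
    existential, since spans are closed under negation; a second copy of [o t] gives zero. *)
Lemma od_monomial t k f r : uniq r -> t \in r ->
  if f t then o t * monomial k f r = 0 else
  exists b : bool, o t * monomial k f r =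
    (-1) ^+ b * monomial k (fun s => f s || (s == t)) r.
Proof.
elim: r => //= s r IH /andP[sr ur]; rewrite in_cons !monomial_cons.
rewrite evXCA; case: eqP => [-> _|/nesym/eqP st /= tr].
  rewrite eqxx orbT; case: ifP => fs; first by rewrite fs expr1 (mulrA (o s)) od_sq mul0r mulr0.
  exists false; rewrite fs !mul1r expr1; congr (_ * (_ * _)); apply: monomial_eq => // u ur' /=.
  by case: eqP => [us|_]; [rewrite -us ur' in sr|rewrite orbF].
rewrite (negPf st) orbF od_exp; have := IH ur tr; case: ifP => _.
  by move=> ->; rewrite !mulr0.
case=> b ->; exists (f s (+) b); rewrite signr_addb.
by case: (f s); case: b; rewrite /= ?mulN1r ?mul1r ?expr0 ?mulrN ?mulNr ?mul1r.
Qed.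

(** * Spans of monomials of given degree and bounded weight *)

Variable ord : seq I.
Hypotheses (ord_uniq : uniq ord) (ord_all : forall s, s \in ord).

Lemma sum_ord (F : I -> int) : \sum_(s <- ord) F s = \sum_s F s.
Proof.
rewrite big_uniq //; apply: eq_bigl => s; exact: ord_all.
Qed.

Local Notation mon k f := (monomial k f ord).

(** The product is the monomial in which every odd exponent is already 1. *)
Lemma od_top_mon t : o t * \prod_(s <- ord) o s = 0.
Proof.
rewrite -(od_monomial (fun=> 0%N) (fun=> true) ord_uniq (ord_all t)).
by congr (_ * _); apply: eq_bigr => s _; rewrite mul1r.
Qed.

Definition weight (k : I -> nat) (f : I -> bool) : nat := (\sum_s (k s + ~~ f s))%N.

Lemma number_op_mon k f : number_op (mon k f) = mon k f *+ weight k f.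
Proof.
rewrite number_op_monomial sum_ord pmulrn; congr (_ *~ _).
rewrite /weight -sum1_card !(big_morph Posz PoszD (erefl _)) -big_split.
by apply: eq_bigr => s _ /=; case: (f s); lia.
Qed.

Definition mon_span (P : (I -> nat) -> (I -> bool) -> Prop) : K -> Prop :=
  sums_of (fun z => exists a k f, P k f /\ z = sc a * mon k f).

Lemma mon_spanW P Q z : (forall k f, P k f -> Q k f) -> mon_span P z -> mon_span Q z.
Proof.
move=> PQ; elim=> [|x y [a [k [f [hP ->]]]] _ IH]; first exact: sums_of0.
by apply: sums_of_cons IH; exists a, k, f; split => //; exact: PQ.
Qed.

Lemma mon_span_map P Q (F : K -> K) : F 0 = 0 -> {morph F : x y / x + y} ->
  (forall a k f, P k f -> mon_span Q (F (sc a * mon k f))) ->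
  forall z, mon_span P z -> mon_span Q (F z).
Proof.
move=> F0 FD FP; apply: (sums_of_map F0 FD) => x [a [k [f [hP ->]]]]; exact: FP.
Qed.

Lemma mon_span_sc P a z : mon_span P z -> mon_span P (sc a * z).
Proof.
apply: (mon_span_map (mulr0 _) (mulrDr _)) => b k f hP.
by apply: sums_of1; exists (a * b), k, f; rewrite scM mulrA.
Qed.

Lemma scN a : sc (- a) = - sc a.
Proof. by apply/eqP; rewrite -addr_eq0 -scD addNr sc0. Qed.

Lemma mon_spanN P z : mon_span P z -> mon_span P (- z).
Proof. by move/(mon_span_sc (-1)); rewrite scN sc1 mulN1r. Qed.

Lemma mon_span_muln P z n : mon_span P z -> mon_span P (z *+ n).
Proof.
move=> hz; elim: n => [|n IH]; first exact: sums_of0.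
by rewrite mulrS; exact: sums_ofD.
Qed.

(* Exactly one of the two generators of index [s] has cohomological degree one:
   [od s] when [odd_gen s] holds, and [ev s] otherwise. *)
Variable odd_gen : I -> bool.

Definition degree (k : I -> nat) (f : I -> bool) : nat :=
  (\sum_s (if odd_gen s then f s : nat else k s))%N.

Definition deg_span i := mon_span (fun k f => degree k f = i).

Lemma deg_span_ev t i z : deg_span i z -> deg_span (~~ odd_gen t + i) (e t * z).
Proof.
apply: (mon_span_map (mulr0 _) (mulrDr _)) => a k f <-.
rewrite -evCA ev_monomial //; apply: sums_of1.
do 3! eexists; split; last reflexivity.
rewrite /degree [RHS]addnC (bigD1 t) //= [in RHS](bigD1 t) //= addnAC; congr (_ + _)%N.
  by rewrite eqxx; case: (odd_gen t); rewrite /= ?addn0.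
by apply: eq_bigr => s /negPf->; rewrite addn0.
Qed.

Lemma deg_span_od t i z : deg_span i z -> deg_span (odd_gen t + i) (o t * z).
Proof.
apply: (mon_span_map (mulr0 _) (mulrDr _)) => a k f <-.
rewrite mulrA od_sc -mulrA; apply: mon_span_sc.
have := od_monomial k f ord_uniq (ord_all t); case: ifP => [_ ->|ft [b ->]].
  exact: sums_of0.
suff h : deg_span (odd_gen t + degree k f) (mon k (fun s => f s || (s == t))).
  by case: b; rewrite ?mulN1r ?mul1r //; exact: mon_spanN.
apply: sums_of1; exists 1; do 2! eexists; split; last by rewrite sc1 mul1r.
rewrite /degree [RHS]addnC (bigD1 t) //= [in RHS](bigD1 t) //= addnAC; congr (_ + _)%N.
  by rewrite eqxx ft; case: (odd_gen t); rewrite /= ?addn0.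
by apply: eq_bigr => s /negPf->; rewrite orbF.
Qed.

Lemma deg_span1 : deg_span 0 1.
Proof.
apply: sums_of1; exists 1, (fun=> 0%N), (fun=> false); split.
  by apply: big1 => s _; case: ifP.
by rewrite sc1 mul1r /monomial big1 // => s _; rewrite mul1r.
Qed.

(** A finite sum of monomials has bounded weight; the bound starts the induction in
    [contraction]. *)
Lemma deg_span_weight i z : deg_span i z ->
  exists N, mon_span (fun k f => degree k f = i /\ (weight k f <= N)%N) z.
Proof.
elim=> [|x y [a [k [f [hP ->]]]] _ [N hN]]; first by exists 0%N; exact: sums_of0.
exists (maxn (weight k f) N); apply: sums_of_cons.
  by exists a, k, f; split=> //; rewrite leq_maxl.
by apply: mon_spanW hN => k' f' [-> hw]; split => //; rewrite leq_max hw orbT.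
Qed.

Definition top_mon : K := \prod_(s <- ord) o s.

Lemma weight_eq0 k f : weight k f = 0%N -> mon k f = top_mon /\ degree k f = (\sum_s odd_gen s)%N.
Proof.
move/eqP; rewrite sum_nat_eq0 => /forallP h.
have {}h s : k s = 0%N /\ f s.
  by move: (h s); rewrite addn_eq0 => /andP[/eqP-> ]; case: (f s).
split; first by apply: eq_bigr => s _; have [-> ->] := h s; rewrite mul1r.
by apply: eq_bigr => s _; have [-> ->] := h s; case: (odd_gen s).
Qed.

Lemma weight0_span i z : mon_span (fun k f => degree k f = i /\ (weight k f <= 0)%N) z ->
  exists2 a, z = sc a * top_mon & i <> (\sum_s odd_gen s)%N -> a = 0.
Proof.
elim=> [|x y [a [k [f [[hd hw] ->]]]] _ [b -> hb]]; first by exists 0; rewrite ?sc0 ?mul0r.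
move: hw; rewrite leqn0 => /eqP/weight_eq0[-> hd'].
exists (a + b); first by rewrite scD mulrDl.
(* Outside the top degree there is no monomial of weight 0, so a summand is contradictory. *)
by move=> ni; case: ni; rewrite -hd.
Qed.

(** * Contraction of cocycles, with division by positive integers *)

Lemma mulrSn_inj n : injective (fun x : K => x *+ n.+1).
Proof.
have [c cn] := sc_inv W n => x y /(congr1 ( *%R (sc c))).
by rewrite /= !mulrnAr -!mulrnAl cn !mul1r.
Qed.

(** The factors e_s e_t are symmetric and o_s o_t antisymmetric in s and t, so the square equals its
    own negative; then 2 is cancelled. *)
Lemma kelt_sq : kelt * kelt = 0.
Proof.
have kkE : kelt * kelt = \sum_s \sum_t e s * (e t * (o s * o t)).
  rewrite mulr_suml; apply: eq_bigr => s _; rewrite mulr_sumr; apply: eq_bigr => t _.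
  by rewrite -!mulrA (evCA t (o s)).
apply: (@mulrSn_inj 1); rewrite mul0rn mulr2n; apply/eqP.
rewrite addr_eq0 kkE [X in _ == - X]exchange_big /= -sumrN; apply/eqP/eq_bigr => s _.
by rewrite -sumrN; apply: eq_bigr => t _; rewrite (odC W s t) !mulrN (evCA t (e s)).
Qed.

(** The primitive is presented as [homotopy u] with [u] in degree i, not as an element of degree i -
    1, so that i = 0 is not a special case of the induction. *)
Lemma contraction N i z :
  mon_span (fun k f => degree k f = i /\ (weight k f <= N)%N) z -> kelt * z = 0 ->
  exists a u, [/\ deg_span i u, z = sc a * top_mon + kelt * homotopy u &
    i <> (\sum_s odd_gen s)%N -> a = 0].
Proof.
elim: N z => [|N IH] z hz dz.
  have [a -> ha] := weight0_span hz; exists a, 0.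
  by rewrite homotopy0 mulr0 addr0; split => //; exact: sums_of0.
have hdeg : deg_span i z by apply: mon_spanW hz => k f [].
(* This combination annihilates monomials of weight N + 1 and only rescales those of smaller
   weight. *)
pose w := z *+ N.+1 - number_op z.
have Lz : number_op z = kelt * homotopy z by rewrite -homotopy_kelt dz homotopy0 add0r.
have dw : kelt * w = 0 by rewrite mulrBr mulrnAr dz mul0rn Lz mulrA kelt_sq mul0r subr0.
have hw : mon_span (fun k f => degree k f = i /\ (weight k f <= N)%N) w.
  apply: (@mon_span_map _ _ (fun x => x *+ N.+1 - number_op x)) hz.
  - by rewrite mul0rn number_op0 subr0.
  - by move=> x y; rewrite mulrnDl number_opD opprD addrACA.
  move=> a k f [hd]; rewrite leq_eqVlt ltnS number_op_sc number_op_mon -mulrnAr -mulrBr.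
  case/orP => [/eqP->|hN]; first by rewrite subrr mulr0; exact: sums_of0.
  apply: mon_span_sc; rewrite -mulrnBr; last exact: leqW.
  by apply: mon_span_muln; apply: sums_of1; exists 1, k, f; rewrite sc1 mul1r.
have [a [u [hu wE ha]]] := IH w hw dw.
have [c cN] := sc_inv W N.
(* As [z] is a cocycle, [number_op z] is D h z; hence (N + 1) z = w + D h z = a top + D h (u + z),
   and [c] inverts N + 1. *)
exists (c * a), (sc c * (u + z)); split.
- by apply: mon_span_sc; exact: sums_ofD.
- apply: (@mulrSn_inj N); rewrite mulrnDl scM -mulrA -mulrnAl cN mul1r -mulrnAr.
  have hn x : homotopy x *+ N.+1 = homotopy (x *+ N.+1).
    by elim: N.+1 => [|n IHn]; rewrite ?homotopy0 // !mulrS homotopyD IHn.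
  by rewrite hn -mulrnAl cN mul1r homotopyD mulrDr addrA -wE -Lz subrK.
- by move=> /ha->; rewrite mulr0.
Qed.

(* Applying the [dod s] one after the other strips the generators [od s] off
   [sc a * top_mon] while preserving the left ideal generated by the [ev s]. *)
Lemma top_mon_faithful (aug : K -> A) a y :
  {morph aug : u v / u + v} -> (forall b, aug (sc b) = b) ->
  (forall s z, aug (ev W s * z) = 0) -> sc a * top_mon = kelt * y -> a = 0.
Proof.
move=> augD aug_sc aug_ev; pose J := sums_of (fun z => exists s x, z = e s * x).
have aug0 : aug 0 = 0 by apply: (addrI (aug 0)); rewrite -augD !addr0.
have JO s z : J z -> J (O s z).
  apply: (sums_of_map (dod0 s) (dodD W s)) => _ [t [x ->]].
  by rewrite dod_ev; apply: sums_of1; exists t, (O s x).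
have Jaug z : J z -> aug z = 0.
  by elim=> [//|_ x [t [u ->]] _ IH]; rewrite augD aug_ev IH addr0.
have JD : J (kelt * y).
  rewrite /kelt mulr_suml; elim/big_rec: _ => [|s x _ hx]; first exact: sums_of0.
  by apply: sums_of_cons hx; exists s, (o s * y); rewrite mulrA.
move=> aE; move: JD; rewrite -aE /top_mon => {aE}.
have O_rest s r : s \notin r -> O s (\prod_(t <- r) o t) = 0.
  elim: r => [_|t r IH]; first by rewrite big_nil dod1.
  by rewrite in_cons negb_or big_cons dod_od => /andP[/negPf-> /IH->]; rewrite mulr0 subr0.
elim: (ord) ord_uniq a => [_ a|s r IH /= /andP[sr ur] a].
  by rewrite big_nil mulr1 => /Jaug; rewrite aug_sc.
rewrite big_cons => /(JO s); rewrite dod_sc dod_od eqxx O_rest // mulr0 subr0.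
(* Moving [dod s] past the scalar turned [a] into [bar a], so the induction hypothesis kills
   [bar a]. *)
by move/(IH ur) => ba; rewrite -[a]barK ba bar0.
Qed.

End KoszulHomotopy.

(** * Supermodules that are free on one homogeneous generator *)

Section FreeGenerator.
Variable A : superRingType.

Definition free_gen (b : bool) (M : superLmodType A) (u : M) : Prop :=
  [/\ homog b u, forall m, exists a, m = a *: u & forall a, a *: u = 0 -> a = 0].

Lemma free_gen_inj b (M : superLmodType A) (u : M) : free_gen b u ->
  injective (fun a : A => a *: u).
Proof.
case=> _ _ u0 a c /= e; apply/eqP; rewrite -subr_eq0; apply/eqP/u0.
by rewrite scalerBl e subrr.
Qed.

(** The map sends a u to a v; it is even because both generators have parity [b]. *)
Lemma free_gen_iso b (M N : superLmodType A) (u : M) (v : N) :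
  free_gen b u -> free_gen b v -> super_iso M N.
Proof.
move=> hu hv; have iu := free_gen_inj hu; have iv := free_gen_inj hv.
case: (hu) (hv) => bu gu _ [bv gv _].
pose cu m := projT1 (cid (gu m)); have cuE m : m = cu m *: u := projT2 (cid (gu m)).
pose cv n := projT1 (cid (gv n)); have cvE n : n = cv n *: v := projT2 (cid (gv n)).
have cu_lin a x y : cu (a *: x + y) = a * cu x + cu y.
  by apply: iu; rewrite -cuE scalerDl -scalerA -!cuE.
pose f m : N := cu m *: v.
have f_lin : linear f by move=> a x y; rewrite /f cu_lin scalerDl scalerA.
pose fL := GRing.isLinear.Build A M N *:%R f f_lin.
pose F : {linear M -> N} := HB.pack f fL.
exists F; split.
  exists (fun n => cv n *: u) => [m|n].
    by rewrite [RHS]cuE; congr (_ *: _); apply: iv; rewrite -cvE.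
  by rewrite [RHS]cvE /= /f; congr (_ *: _); apply: iu; rewrite -cuE.
(* For [m] of parity c the coordinate has parity c + b, hence equals its own component of that
   parity. *)
move=> c m hm; rewrite [F m](_ : _ = part (c (+) b) (cu m) *: v).
  have : homog ((c (+) b) (+) b) (part (c (+) b) (cu m) *: v).
    by apply: homogZ => //; exact: homog_part.
  by rewrite -addbA addbb addbF.
congr (_ *: _); apply: iu; rewrite -cuE.
move/homogP: hm => hm; rewrite -[LHS]hm {1}(cuE m) partZ !(part_homog _ bu).
by case: (c) (b) => [] [] /=; rewrite ?scaler0 ?addr0 ?add0r.
Qed.

(** Scalars act on [Pi M] through [bar], so coordinates are twisted by this involution and the
    generator changes parity. *)
Lemma free_gen_Pi b (M : superLmodType A) (u : M) :
  free_gen b u -> free_gen (~~ b) (to_Pi u).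
Proof.
case=> /homogP hu gu u0; split.
- by apply/homogP; rewrite [LHS](_ : _ = to_Pi (part (~~ ~~ b) u)) // negbK hu.
- move=> m; have [a ma] := gu (of_Pi m); exists (bar a).
  by rewrite [RHS](_ : _ = to_Pi (bar (bar a) *: u)) // barK -ma.
- by move=> a h; rewrite -[a]barK (u0 (bar a)) ?bar0.
Qed.

Lemma free_gen_iterPi n : exists u : iterPi n A^o, free_gen (odd n) u.
Proof.
elim: n => [|n [u hu]]; last by exists (to_Pi u); exact: free_gen_Pi.
exists 1; split; first exact: homog1.
  by move=> m; exists m; rewrite [RHS]mulr1.
by move=> a; rewrite [LHS]mulr1.
Qed.

End FreeGenerator.

(** * Multiplications and augmentation on a tensor product of supersymmetric algebras *)

Section TensorOperators.
Variables (A : superComRingType) (M N : superLmodType A).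
Local Notation T := (Tensor (Sym M) (Sym N)).
Local Notation lt x := (@tens A (Sym M) (Sym N) x 1).
Local Notation rt y := (@tens A (Sym M) (Sym N) 1 y).

Lemma tens_l (x r : Sym M) (u : Sym N) : lt x * tens r u = tens (x * r) u.
Proof. by rewrite tensM !(part_homog _ homog1) mul0r tens0r mul1r addr0. Qed.

Lemma tens_r c (y u : Sym N) (r : Sym M) : homog c y ->
  rt y * tens r u = tens (sbar c r) (y * u).
Proof.
move=> hy; rewrite tensM !(part_homog _ hy) !mul1r.
by case: c hy => _; rewrite /= mul0r tens0r ?addr0 ?add0r.
Qed.

Lemma tens_1M (x y : Sym N) : rt (x * y) = rt x * rt y.
Proof. by rewrite tensM (bar_homog homog1) mul1r -tensDr -mulrDl part_sum. Qed.

Lemma tens_scE a (z : T) : a *: z = (a *: (1 : T)) * z.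
Proof. by rewrite -[in LHS](mul1r z) [LHS]tens_scaleAl. Qed.

Lemma tens_1Z a (x : Sym N) : rt (a *: x) = a *: rt x.
Proof. by rewrite -tens_rscale sym_rscaleE mul1r tensZ sym_scaleE mulr1. Qed.

Lemma tens_cst a : rt (sym_cst N a) = a *: (1 : T).
Proof. by rewrite -[sym_cst N a]mulr1 -sym_scaleE tens_1Z. Qed.

Definition taug : T -> A := tlift (fun r u => aug r * aug u).

Lemma taug_balanced : balanced (fun (r : Sym M) (u : Sym N) => aug r * aug u).
Proof.
split=> [r r' u|r u u'|r a u]; [by rewrite augD mulrDl|by rewrite augD mulrDr|].
by rewrite sym_rscaleE sym_scaleE !augM !aug_cst mulrA.
Qed.

Lemma taugE r u : taug (tens r u) = aug r * aug u.
Proof. exact: (tliftE taug_balanced). Qed.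

Lemma taugD : {morph taug : x y / x + y}.
Proof. exact: (tliftD taug_balanced). Qed.

Lemma taug_sc a : taug (a *: (1 : T)) = a.
Proof.
by rewrite tensZ taugE sym_scaleE mulr1 aug_cst -[1]/(sym_cst N 1) aug_cst mulr1.
Qed.

Lemma taug_l m z : taug (lt (sym_gen m) * z) = 0.
Proof.
elim/Tensor_ind: z => [r u|x y IHx IHy].
  by rewrite tens_l taugE augM aug_gen !mul0r.
by rewrite mulrDr taugD IHx IHy addr0.
Qed.

Lemma taug_r c m z : homog c m -> taug (rt (sym_gen m) * z) = 0.
Proof.
move=> hm; elim/Tensor_ind: z => [r u|x y IHx IHy].
  by rewrite (tens_r _ _ (homog_gen hm)) taugE augM aug_gen mul0r mulr0.
by rewrite mulrDr taugD IHx IHy addr0.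
Qed.

End TensorOperators.

(** * Superderivations of the tensor product along its first factor *)

Section LeftDerivation.
Variables (A : superComRingType) (M N : superLmodType A).
Variables (b : bool) (phi : M -> A).
Hypothesis phiS : super_form b phi.
Local Notation T := (Tensor (Sym M) (Sym N)).
Local Notation lt x := (@tens A (Sym M) (Sym N) x 1).
Local Notation rt y := (@tens A (Sym M) (Sym N) 1 y).

Definition tderl : T -> T := tlift (fun r u => tens (der b phi r) u).

Lemma tderl_balanced :
  balanced (fun (r : Sym M) (u : Sym N) => tens (der b phi r) u : T).
Proof.
split=> [r r' u|r u u'|r a u]; [by rewrite (derD phiS) tensDl|exact: tensDr|].
by rewrite (der_rscale phiS) tens_rscale.
Qed.

Lemma tderlE r u : tderl (tens r u) = tens (der b phi r) u.
Proof. exact: (tliftE tderl_balanced). Qed.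

Lemma tderlD : {morph tderl : x y / x + y}.
Proof. exact: (tliftD tderl_balanced). Qed.

Lemma tderl1 : tderl 1 = 0.
Proof. by rewrite tderlE (der1 phiS) tens0l. Qed.

Lemma tderl_l m z : tderl (lt (sym_gen m) * z) =
  phi m *: z + lt (sym_gen (sbar b m)) * tderl z.
Proof.
elim/Tensor_ind: z => [r u|x y IHx IHy]; last first.
  by rewrite mulrDr !tderlD IHx IHy scalerDr mulrDr addrACA.
by rewrite tens_l !tderlE tens_l (derM phiS) (der_gen phiS) tensDl tensZ sbar_gen.
Qed.

Lemma tderl_r c m z : homog c m -> tderl (rt (sym_gen m) * z) =
  if b && c then - (rt (sym_gen m) * tderl z) else rt (sym_gen m) * tderl z.
Proof.
move=> hm; elim/Tensor_ind: z => [r u|x y IHx IHy]; last first.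
  by rewrite mulrDr !tderlD IHx IHy mulrDr; case: ifP; rewrite ?opprD.
rewrite !tderlE !(tens_r _ _ (homog_gen hm)) tderlE (der_sbar phiS).
by case: ifP; rewrite ?tensNl.
Qed.

Lemma tderl_scale a z : tderl (a *: z) = sbar b a *: tderl z.
Proof.
elim/Tensor_ind: z => [r u|x y IHx IHy]; last first.
  by rewrite scalerDr !tderlD IHx IHy scalerDr.
by rewrite tensZ !tderlE (derZ phiS) tensZ.
Qed.

End LeftDerivation.

(** * Superderivations of the tensor product along its second factor *)

Section RightDerivation.
Variables (A : superComRingType) (M N : superLmodType A).
Variables (b : bool) (phi : N -> A).
Hypothesis phiS : super_form b phi.
Local Notation T := (Tensor (Sym M) (Sym N)).
Local Notation lt x := (@tens A (Sym M) (Sym N) x 1).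
Local Notation rt y := (@tens A (Sym M) (Sym N) 1 y).

(** The derivation must cross the first factor to reach the second, which accounts for the twist of
    [r]. *)
Definition tderr : T -> T := tlift (fun r u => tens (sbar b r) (der b phi u)).

Lemma tderr_balanced :
  balanced (fun (r : Sym M) (u : Sym N) => tens (sbar b r) (der b phi u) : T).
Proof.
split=> [r r' u|r u u'|r a u].
- by rewrite sbarD tensDl.
- by rewrite (derD phiS) tensDr.

by rewrite (derZ phiS) -tens_rscale !sym_rscaleE sbarM sbar_cst.
Qed.

Lemma tderrE r u : tderr (tens r u) = tens (sbar b r) (der b phi u).
Proof. exact: (tliftE tderr_balanced). Qed.

Lemma tderrD : {morph tderr : x y / x + y}.
Proof. exact: (tliftD tderr_balanced). Qed.

Lemma tderr1 : tderr 1 = 0.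
Proof. by rewrite tderrE (der1 phiS) tens0r. Qed.

Lemma tderr_l m z : tderr (lt (sym_gen m) * z) =
  lt (sym_gen (sbar b m)) * tderr z.
Proof.
elim/Tensor_ind: z => [r u|x y IHx IHy]; last first.
  by rewrite mulrDr !tderrD IHx IHy mulrDr.
by rewrite tens_l !tderrE tens_l sbarM sbar_gen.
Qed.

Lemma tderr_r c m z : homog c m -> tderr (rt (sym_gen m) * z) =
  phi m *: z + rt (sym_gen (sbar b m)) * tderr z.
Proof.
move=> hm; elim/Tensor_ind: z => [r u|x y IHx IHy]; last first.
  by rewrite mulrDr !tderrD IHx IHy scalerDr mulrDr addrACA.
have hphi : homog (b (+) c) (phi m) by case: phiS => _ _; exact.
have hs : homog c (sbar b m).
  by rewrite (sbar_homog _ hm); case: ifP => // _; exact: homogN.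
(* The scalar [phi m] is moved into the second factor as a constant of parity b + c, so that all
   terms become pure tensors. *)
rewrite tens_scE -tens_cst (tens_r _ _ (homog_cst _ hphi)) (tens_r _ _ (homog_gen hm)).
rewrite !tderrE (tens_r _ _ (homog_gen hs)) (derM phiS) (der_gen phiS) sbar_gen tensDr.
by rewrite (sbarC c b); congr (tens _ _ + _); case: (b) (c) => [] []; rewrite //= barK.
Qed.

Lemma tderr_scale a z : tderr (a *: z) = sbar b a *: tderr z.
Proof.
elim/Tensor_ind: z => [r u|x y IHx IHy]; last first.
  by rewrite scalerDr !tderrD IHx IHy scalerDr.
by rewrite tensZ !tderrE sbarZ tensZ.
Qed.

End RightDerivation.

(** * Coordinate forms on V and on the dual of Pi V *)

Section Coordinates.
Variables (A : superComRingType) (p q : nat).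
Local Notation V := (sfree A p q).
Local Notation W := (dual (Pi V)).
Local Notation I := ('I_p + 'I_q)%type.

(** The left coordinate is linear without signs; the twist makes it a [super_form] of the parity of
    s. [dform] twists evaluation at a basis vector of Pi V in the same way. *)
Definition vform (s : I) (v : V) : A := sbar (is_odd_index s) (v s : A).

Definition dform (s : I) (f : W) : A :=
  sbar (~~ is_odd_index s) (f (to_Pi (svec A s)) : A).

Lemma vform_super s : super_form (is_odd_index s) (vform s).
Proof.
split=> [v w|a v|c v /homogP hv].
- by rewrite /vform ffunE sbarD.
- by rewrite /vform ffunE sbarM.
- have hs : homog (is_odd_index s (+) c) (v s : A).
    by rewrite -hv ffunE addbC; exact: homog_part.
  by rewrite /vform (sbar_homog _ hs); case: ifP => // _; exact: homogN.
Qed.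

Lemma dform_super s : super_form (~~ is_odd_index s) (dform s).
Proof.
split=> [f g|a f|c f /homogP hf].
- by rewrite /dform -sbarD.
- by rewrite /dform -sbarM.
- have hs : homog (~~ is_odd_index s (+) c) (f (to_Pi (svec A s)) : A).
    have hv d : part d (to_Pi (svec A s)) =
        if d == ~~ is_odd_index s then to_Pi (svec A s) else 0.
      rewrite [LHS](_ : _ = to_Pi (part (~~ d) (svec A s))) //.
      rewrite (part_homog _ (homog_svec A s)).
      by case: d; case: (is_odd_index s).
    rewrite -hf /= /dpart !hv; case: (is_odd_index s) => /=.
      by rewrite dual_fun0 (@part0 A) addr0; exact: homog_part.
    by rewrite dual_fun0 (@part0 A) add0r; exact: homog_part.
  by rewrite /dform (sbar_homog _ hs); case: ifP => // _; exact: homogN.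
Qed.

Lemma vform_svec s t : vform s (svec A t) = (s == t)%:R.
Proof.
rewrite /vform ffunE; case: eqP => _; last exact: sbar0.
by rewrite (sbar_homog _ homog1) andbF.
Qed.

Lemma dform_basis s t : dform s (dual_basis A t) = (s == t)%:R.
Proof.
rewrite /dform dual_basisE eq_sym; case: eqP => _; last exact: sbar0.
by rewrite (sbar_homog _ homog1) andbF.
Qed.

Lemma svec_expand (v : V) : v = \sum_s v s *: svec A s.
Proof.
apply/ffunP=> t; rewrite sum_ffunE (bigD1 t) //= !ffunE eqxx big1 ?addr0.
  by rewrite [RHS]mulr1.
by move=> s /negPf st; rewrite !ffunE eq_sym st scaler0.
Qed.

(** A functional is linear on the right, so the vector is expanded in right coordinates, which are
    exactly the values of the dual basis on it. *)
Lemma dual_expand (f : W) : f = \sum_s f (to_Pi (svec A s)) *: dual_basis A s.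
Proof.
have [fD fZ] := dual_rlinear f.
apply: dualP => m; pose c s := coord_fun s m : A.
have mE : m = \sum_s rscale (to_Pi (svec A s)) (c s) :> Pi V.
  rewrite [LHS](svec_expand (of_Pi m)).
  apply: eq_bigr => s _.
  rewrite [RHS](_ : _ = rscale (svec A s) (c s)); last exact: pi_rscaleE.
  rewrite /rscale (bar_homog (homog_svec A s)) /c /coord_fun.
  case: (is_odd_index s); last by rewrite -scalerDl part_sum.
  by rewrite scalerN -scalerBl -/(bar (bar _)) barK.
have sumE (g : W) (F : I -> Pi V) : g (\sum_s F s) = \sum_s g (F s).
  by apply: (big_morph g (dual_rlinear g).1 (dual_fun0 g)).
rewrite [in LHS]mE sumE.
rewrite (big_morph (fun g : W => g m : A) (id1 := 0) (op1 := +%R)) //.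
by apply: eq_bigr => s _; rewrite fZ.
Qed.

End Coordinates.

(** * The Weyl structure attached to two bases of opposite parities *)

Section KoszulWeyl.
Variables (A : superComRingType) (I : finType) (M N : superLmodType A) (par : I -> bool).
Variables (x : I -> M) (y : I -> N) (phi : I -> M -> A) (psi : I -> N -> A).
Hypothesis nat_inv : forall n, exists c : A, c *+ n.+1 = 1.
Hypothesis phi_super : forall s, super_form (par s) (phi s).
Hypothesis psi_super : forall s, super_form (~~ par s) (psi s).
Hypothesis homog_x : forall s, homog (par s) (x s).
Hypothesis homog_y : forall s, homog (~~ par s) (y s).
Hypothesis phi_x : forall s t, phi s (x t) = (s == t)%:R.
Hypothesis psi_y : forall s t, psi s (y t) = (s == t)%:R.

Local Notation K := (Tensor (Sym M) (Sym N)).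

Definition vgen (s : I) : K := tens (sym_gen (x s)) (1 : Sym N).
Definition wgen (s : I) : K := tens (1 : Sym M) (sym_gen (y s)).
Definition vder (s : I) : K -> K := tderl (par s) (phi s).
Definition wder (s : I) : K -> K := tderr (~~ par s) (psi s).

Definition kscalar (a : A) : K := a *: (1 : K).
(** The two generators of index s have opposite parities; [par s] tells which of them is even. *)
Definition kev (s : I) : K := if par s then wgen s else vgen s.
Definition kod (s : I) : K := if par s then vgen s else wgen s.
Definition kdev (s : I) : K -> K := if par s then wder s else vder s.
Definition kdod (s : I) : K -> K := if par s then vder s else wder s.

Lemma homog_vgen s : homog (par s) (vgen s).
Proof.
have := homog_tens (homog_gen (homog_x s)) (@homog1 (Sym N)).
by rewrite addbF.
Qed.

Lemma homog_wgen s : homog (~~ par s) (wgen s).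
Proof. exact: (homog_tens (@homog1 (Sym M)) (homog_gen (homog_y s))). Qed.

Lemma homog_kev s : homog false (kev s).
Proof.
rewrite /kev; have := homog_vgen s; have := homog_wgen s.
by case: (par s).
Qed.

Lemma homog_kod s : homog true (kod s).
Proof.
rewrite /kod; have := homog_vgen s; have := homog_wgen s.
by case: (par s).
Qed.

Lemma kscalarE a (z : K) : kscalar a * z = a *: z.
Proof. by rewrite [RHS]tens_scE. Qed.

Lemma part_kscalar b a : part b (kscalar a) = kscalar (part b a).
Proof.
rewrite /kscalar partZ !(part_homog _ (@homog1 K)).
by case: b; rewrite /= scaler0 ?addr0 ?add0r.
Qed.

Lemma kod_sc s a : kod s * kscalar a = kscalar (bar a) * kod s.
Proof.
rewrite (supermulE (kod s)) (bar_homog (homog_kod s)) !part_kscalar mulrN -mulrBl.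
by rewrite /kscalar -scalerBl.
Qed.

Lemma kevC s (z : K) : kev s * z = z * kev s.
Proof.
by rewrite (supermulE z) !(part_homog _ (homog_kev s)) mul0r addr0.
Qed.

Lemma kodC s t : kod s * kod t = - (kod t * kod s).
Proof. exact: (supermul_sign (homog_kod s) (homog_kod t)). Qed.

Lemma kscalar_inv n : exists c, kscalar c *+ n.+1 = 1.
Proof.
have [c cn] := nat_inv n; exists c.
by rewrite /kscalar scalerMnl cn scale1r.
Qed.

(** The odd generator anticommutes with itself, so twice its square vanishes, and 2 is
    invertible. *)
Lemma kod_sq s : kod s * kod s = 0.
Proof.
have [c c2] := kscalar_inv 1; set u := _ * _.
have u2 : u *+ 2 = 0 by rewrite mulr2n {1}/u kodC addNr.
by rewrite -[u]mul1r -c2 mulrnAl -mulrnAr u2 mulr0.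
Qed.

Lemma vder_vgen s t z : vder s (vgen t * z) = (if s == t then z else 0) +
  if par s && par t then - (vgen t * vder s z) else vgen t * vder s z.
Proof.
rewrite /vder (tderl_l (phi_super s)) phi_x; congr (_ + _).
  by case: eqP; rewrite ?scale1r ?scale0r.
rewrite (sbar_homog _ (homog_x t)); case: ifP => // _.
by rewrite sym_genN tensNl mulNr.
Qed.

Lemma vder_wgen s t z : vder s (wgen t * z) =
  if par s && ~~ par t then - (wgen t * vder s z) else wgen t * vder s z.
Proof. exact: (tderl_r (phi_super s) _ (homog_y t)). Qed.

Lemma wder_vgen s t z : wder s (vgen t * z) =
  if ~~ par s && par t then - (vgen t * wder s z) else vgen t * wder s z.
Proof.
rewrite /wder (tderr_l (psi_super s)) (sbar_homog _ (homog_x t)).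
by case: ifP => // _; rewrite sym_genN tensNl mulNr.
Qed.

Lemma wder_wgen s t z : wder s (wgen t * z) = (if s == t then z else 0) +
  if ~~ par s && ~~ par t then - (wgen t * wder s z)
  else wgen t * wder s z.
Proof.
rewrite /wder (tderr_r (psi_super s) _ (homog_y t)) psi_y; congr (_ + _).
  by case: eqP; rewrite ?scale1r ?scale0r.
rewrite (sbar_homog _ (homog_y t)); case: ifP => // _.
by rewrite sym_genN tensNr mulNr.
Qed.

Lemma vderD s : {morph vder s : u v / u + v}.
Proof. exact: (tderlD (phi_super s)). Qed.

Lemma wderD s : {morph wder s : u v / u + v}.
Proof. exact: (tderrD (psi_super s)). Qed.

Lemma vder_sc s a z : vder s (kscalar a * z) = kscalar (sbar (par s) a) * vder s z.
Proof. by rewrite !kscalarE; exact: (tderl_scale (phi_super s)). Qed.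

Lemma wder_sc s a z :
  wder s (kscalar a * z) = kscalar (sbar (~~ par s) a) * wder s z.
Proof. by rewrite !kscalarE; exact: (tderr_scale (psi_super s)). Qed.

Lemma vder1 s : vder s 1 = 0. Proof. exact: (tderl1 _ (phi_super s)). Qed.
Lemma wder1 s : wder s 1 = 0. Proof. exact: (tderr1 _ (psi_super s)). Qed.

Lemma odd_index_neq (s t : I) : par s != par t -> (s == t) = false.
Proof. by apply: contraNF => /eqP->. Qed.

(** Each relation splits on the parities of the two indices; indices of different parity are
    distinct, so the Kronecker term is then absent. The definition stays transparent because later
    proofs unfold its projections. *)
Definition koszul_weyl : superWeyl A I K.
Proof.
refine (@SuperWeyl A I K kscalar kev kod kdev kdod _ _ _ kscalar_inv kevC kodC kod_sq kod_sc
  _ _ _ _ _ _ _ _ _ _).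
- exact: scalerDl.
- by move=> a b; rewrite kscalarE /kscalar scalerA.
- exact: scale1r.
- by move=> s u v; rewrite /kdev; case: ifP => _; [exact: wderD|exact: vderD].
- by move=> s u v; rewrite /kdod; case: ifP => _; [exact: vderD|exact: wderD].
- by move=> s; rewrite /kdev; case: ifP => _; [exact: wder1|exact: vder1].
- by move=> s; rewrite /kdod; case: ifP => _; [exact: vder1|exact: wder1].
- move=> s a z; rewrite /kdev; case: ifP => os; first by rewrite wder_sc os.
  by rewrite vder_sc os.
- move=> s a z; rewrite /kdod; case: ifP => os; first by rewrite vder_sc os.
  by rewrite wder_sc os.
- move=> s t z; rewrite /kdev /kev; case os: (par s); case ot: (par t).
  + by rewrite wder_wgen os ot.
  + by rewrite wder_vgen os ot odd_index_neq ?os ?ot ?add0r.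
  + by rewrite vder_wgen os ot odd_index_neq ?os ?ot ?add0r.
  + by rewrite vder_vgen os ot.
- move=> s t z; rewrite /kdev /kod; case os: (par s); case ot: (par t).
  + by rewrite wder_vgen os ot.
  + by rewrite wder_wgen os ot odd_index_neq ?os ?ot ?add0r.
  + by rewrite vder_vgen os ot odd_index_neq ?os ?ot ?add0r.
  + by rewrite vder_wgen os ot.
- move=> s t z; rewrite /kdod /kev; case os: (par s); case ot: (par t).
  + by rewrite vder_wgen os ot.
  + by rewrite vder_vgen os ot odd_index_neq ?os ?ot ?add0r.
  + by rewrite wder_wgen os ot odd_index_neq ?os ?ot ?add0r.
  + by rewrite wder_vgen os ot.
- move=> s t z; rewrite /kdod /kod; case os: (par s); case ot: (par t).
  + by rewrite vder_vgen os ot.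
  + by rewrite vder_wgen os ot odd_index_neq ?os ?ot ?add0r.
  + by rewrite wder_vgen os ot odd_index_neq ?os ?ot ?add0r.
  + by rewrite wder_wgen os ot.
Defined.


(** * Cohomological degree compared with the degree of monomials *)

Local Notation KW := koszul_weyl.
Local Notation lt x := (@tens A (Sym M) (Sym N) x 1).
Local Notation rt y := (@tens A (Sym M) (Sym N) 1 y).

(** For the bases of V and of the dual of Pi V this unfolds to [koszul_deg]. *)
Definition tdeg i : K -> Prop :=
  sums_of (fun z => exists r u, sympow i u /\ z = tens r u).

Lemma tdeg_scale i a z : tdeg i z -> tdeg i (kscalar a * z).
Proof.
apply: (sums_of_map (mulr0 _) (mulrDr _)) => _ [r [u [hu ->]]]; rewrite kscalarE tensZ.
by apply: sums_of1; do 2! eexists; split; [exact: hu|].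
Qed.

Lemma tdeg_vgen s i z : tdeg i z -> tdeg i (vgen s * z).
Proof.
apply: (sums_of_map (mulr0 _) (mulrDr _)) => _ [r [u [hu ->]]]; rewrite tens_l.
by apply: sums_of1; do 2! eexists; split; [exact: hu|].
Qed.

Lemma tdeg_wgen s i z : tdeg i z -> tdeg i.+1 (wgen s * z).
Proof.
apply: (sums_of_map (mulr0 _) (mulrDr _)) => _ [r [u [hu ->]]].
rewrite (tens_r _ _ (homog_gen (homog_y s))).
by apply: sums_of1; do 2! eexists; split; last reflexivity; exact: sympow_gen.
Qed.

Lemma tdeg_kev s i z : tdeg i z -> tdeg (par s + i) (kev s * z).
Proof.
rewrite /kev; case: (par s) => hz; [exact: tdeg_wgen|exact: tdeg_vgen].
Qed.

Lemma tdeg_kod s i z : tdeg i z -> tdeg (~~ par s + i) (kod s * z).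
Proof.
rewrite /kod; case: (par s) => hz; [exact: tdeg_vgen|exact: tdeg_wgen].
Qed.

Lemma tdeg1 : tdeg 0 1.
Proof.
apply: sums_of1; exists 1, 1; split=> //.
by have := sympow_seq 1 ([::] : seq N); rewrite big_nil scale1r.
Qed.

Lemma tdeg_monomial k (f : I -> bool) (r : seq I) :
  tdeg (\sum_(s <- r) (if ~~ par s then f s : nat else k s))%N (monomial KW k f r).
Proof.
elim: r => [|s r IH]; first by rewrite /monomial !big_nil; exact: tdeg1.
rewrite monomial_cons big_cons.
have {}IH : tdeg (~~ par s * f s + \sum_(s <- r) (if ~~ par s then f s : nat else k s))%N
    (kod s ^+ f s * monomial KW k f r).
  by case: (f s); rewrite ?muln0 ?mul1r // muln1 expr1; exact: tdeg_kod.
suff h n : tdeg (par s * n + (~~ par s * f s +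
    \sum_(s <- r) (if ~~ par s then f s : nat else k s)))%N
    (kev s ^+ n * (kod s ^+ f s * monomial KW k f r)).
  by have := h (k s); case: (par s); rewrite /= ?mul1n ?mul0n ?add0n.
elim: n => [|n IHn]; first by rewrite muln0 mul1r.
by rewrite exprS -mulrA mulnS -addnA; exact: tdeg_kev.
Qed.

Variable ord : seq I.
Hypotheses (ord_uniq : uniq ord) (ord_all : forall s, s \in ord).
(** Degree one belongs to the generators from [N], and these are the odd ones exactly when [par s]
    fails. *)
Local Notation span := (deg_span KW ord (fun s => ~~ par s)).

Lemma span_tdeg i z : span i z -> tdeg i z.
Proof.
elim=> [|_ v [a [k [f [<- ->]]]] _ IH]; first exact: sums_of0.
apply: sums_ofD IH; apply: tdeg_scale.
have -> : degree (fun s => ~~ par s) k f =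
    (\sum_(s <- ord) (if ~~ par s then f s : nat else k s))%N.
  by rewrite big_uniq //; apply: eq_bigl => s; rewrite ord_all.
exact: tdeg_monomial.
Qed.

Hypothesis x_span : forall m : M, exists c, m = \sum_s c s *: x s.
Hypothesis y_span : forall n : N, exists c, n = \sum_s c s *: y s.

Lemma span_vgen s i z : span i z -> span i (vgen s * z).
Proof.
move=> hz; case ps: (par s).
  have := deg_span_od ord_uniq ord_all s hz; rewrite ps.
  by rewrite [od _ _](_ : _ = vgen s) //= /kod ps.
have := deg_span_ev ord_uniq ord_all s hz; rewrite ps.
by rewrite [ev _ _](_ : _ = vgen s) //= /kev ps.
Qed.

Lemma span_wgen s i z : span i z -> span i.+1 (wgen s * z).
Proof.
move=> hz; case ps: (par s).
  have := deg_span_ev ord_uniq ord_all s hz; rewrite ps.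
  by rewrite [ev _ _](_ : _ = wgen s) //= /kev ps.
have := deg_span_od ord_uniq ord_all s hz; rewrite ps.
by rewrite [od _ _](_ : _ = wgen s) //= /kod ps.
Qed.

Lemma span_l (r : Sym M) i z : span i z -> span i (lt r * z).
Proof.
elim/Sym_ind: r i z => [a|m|r r' IHr IHr'|r IHr|r r' IHr IHr'] i z hz.
- rewrite -[sym_cst M a]mulr1 -sym_scaleE -tensZ; exact: mon_span_sc.
- have [c ->] := x_span m; rewrite (big_morph (@sym_gen A M) (@sym_genD A M) (@sym_gen0 A M)).
  rewrite (big_morph (fun r => tens r (1 : Sym N)) (id1 := 0) (op1 := +%R)); last first.
  + exact: tens0l.
  + by move=> u v; rewrite tensDl.
  rewrite mulr_suml; elim/big_rec: _ => [|s v _ hv]; first exact: sums_of0.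
  apply: sums_ofD hv; rewrite sym_gen_scale -sym_scaleE -tensZ -tens_scaleAl -kscalarE.
  by apply: mon_span_sc; exact: span_vgen.
- by rewrite tensDl mulrDl; apply: sums_ofD; [exact: IHr|exact: IHr'].
- by rewrite tensNl mulNr; apply: mon_spanN; exact: IHr.
- by rewrite -tens_l -mulrA; apply: IHr; exact: IHr'.
Qed.

Lemma span_r (n : N) i z : span i z -> span i.+1 (rt (sym_gen n) * z).
Proof.
move=> hz; have [c ->] := y_span n.
rewrite (big_morph (@sym_gen A N) (@sym_genD A N) (@sym_gen0 A N)).
rewrite (big_morph (fun u => tens (1 : Sym M) u) (id1 := 0) (op1 := +%R)); last first.
- exact: tens0r.
- by move=> u v; rewrite tensDr.
rewrite mulr_suml; elim/big_rec: _ => [|s v _ hv]; first exact: sums_of0.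
apply: sums_ofD hv; rewrite sym_gen_scale -sym_scaleE tens_1Z -tens_scaleAl -kscalarE.
by apply: mon_span_sc; exact: span_wgen.
Qed.

(** A tensor of degree i is built from 1 by i multiplications from [N] and one from [Sym M]; all
    preserve monomial spans because the [x s] and [y s] span their modules. *)
Lemma tdeg_span i z : tdeg i z -> span i z.
Proof.
elim=> [|_ v [r [u [hu ->]]] _ IH]; first exact: sums_of0.
apply: sums_ofD IH; have -> : tens r u = lt r * rt u by rewrite tens_l mulr1.
apply: span_l; elim: hu => [|_ w [a [t ->]] _ IH]; first by rewrite tens0r; exact: sums_of0.
rewrite tensDr; apply: sums_ofD IH.
rewrite tens_1Z -kscalarE; apply: mon_span_sc.
rewrite -{1}(size_tuple t); elim: (tval t) => [|n l IH] /=.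
  by rewrite big_nil; exact: deg_span1.
by rewrite big_cons tens_1M; exact: span_r.
Qed.

Lemma vder0 s : vder s 0 = 0.
Proof. by apply: (addrI (vder s 0)); rewrite -vderD !addr0. Qed.

Lemma wder0 s : wder s 0 = 0.
Proof. by apply: (addrI (wder s 0)); rewrite -wderD !addr0. Qed.

Lemma tdeg_vder s i z : tdeg i z -> tdeg i (vder s z).
Proof.
apply: (sums_of_map (vder0 s) (vderD s)) => _ [r [u [hu ->]]].
apply: sums_of1; exists (der (par s) (phi s) r), u; split=> //.
exact: (tderlE (phi_super s)).
Qed.

Lemma tdeg_wder s i z : tdeg i.+1 z -> tdeg i (wder s z).
Proof.
apply: (sums_of_map (wder0 s) (wderD s)) => _ [r [u [hu ->]]].
apply: sums_of1; exists (sbar (~~ par s) r), (der (~~ par s) (psi s) u).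
by split; [exact: (der_sympow (psi_super s))|exact: (tderrE (psi_super s))].
Qed.

Lemma tdeg0_wder s z : tdeg 0 z -> wder s z = 0.
Proof.
elim=> [|_ v [r [u [hu ->]]] _ IH]; first exact: wder0.
rewrite wderD IH addr0 /wder (tderrE (psi_super s)).
by rewrite (der_sympow0 (psi_super s) hu) tens0r.
Qed.

(** Each term differentiates once along [M], which keeps the degree, and once along [N], which
    lowers it by 1. *)
Lemma tdeg_homotopy i z : tdeg i.+1 z -> tdeg i (homotopy KW z).
Proof.
move=> hz; rewrite /homotopy; elim/big_rec: _ => [|s v _]; first exact: sums_of0.
apply: sums_ofD; rewrite /= /kdev /kdod; case: (par s).
  exact/tdeg_wder/tdeg_vder.
exact/tdeg_vder/tdeg_wder.
Qed.

Lemma tdeg0_homotopy z : tdeg 0 z -> homotopy KW z = 0.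
Proof.
move=> hz; apply: big1 => s _; rewrite /= /kdev /kdod; case: (par s).
  exact/tdeg0_wder/tdeg_vder.
by rewrite tdeg0_wder // vder0.
Qed.

Lemma koszul_cocycle i z : tdeg i z -> kelt KW * z = 0 ->
  exists a, (i <> (\sum_s ~~ par s)%N -> a = 0) /\
    if i is j.+1 then exists2 u, tdeg j u & z - a *: top_mon KW ord = kelt KW * u
    else z = a *: top_mon KW ord.
Proof.
move=> hz dz; have [n hn] := deg_span_weight (tdeg_span hz).
have [a [u [hu -> ha]]] := contraction ord_uniq ord_all hn dz.
exists a; split=> //; rewrite kscalarE; have {}hu := span_tdeg hu.
(* In degree 0 the homotopy vanishes, so the cocycle is itself a multiple of the top monomial. *)
case: i hz hn hu ha => [|i] _ _ hu _; first by rewrite (tdeg0_homotopy hu) mulr0 addr0.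
by exists (homotopy KW u); [exact: tdeg_homotopy|rewrite addrAC subrr add0r].
Qed.

Lemma koszul_top_faithful a z : a *: top_mon KW ord = kelt KW * z -> a = 0.
Proof.
rewrite -kscalarE; apply: (top_mon_faithful ord_uniq (@taugD A M N)).
- exact: taug_sc.
- move=> s w; rewrite /= /kev; case: (par s); [exact: (taug_r _ (homog_y s))|exact: taug_l].
Qed.

Lemma koszul_top_free a : a *: top_mon KW ord = 0 -> a = 0.
Proof. by move=> h; apply: (@koszul_top_faithful a 0); rewrite mulr0. Qed.

Lemma koszul_top_cocycle : kelt KW * top_mon KW ord = 0.
Proof.
rewrite /kelt mulr_suml big1 // => s _.
by rewrite -mulrA (od_top_mon KW ord_uniq ord_all) mulr0.
Qed.

(** The even generator is central, so e_s o_s is the product of the two generators in either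
    order. *)
Lemma koszul_keltE : kelt KW = \sum_s tens (sym_gen (x s)) (sym_gen (y s)).
Proof.
apply: eq_bigr => s _; have -> : tens (sym_gen (x s)) (sym_gen (y s)) = vgen s * wgen s.
  by rewrite [RHS]tens_l mulr1.
rewrite /= /kev /kod; have := kevC s; rewrite /kev; case: (par s) => // h; exact: h.
Qed.

(** With the odd indices listed first, all factors from [M] stand left of those from [N], and no
    sign arises. *)
Lemma koszul_top_monE r1 r2 : {in r1, forall s, par s} -> {in r2, forall s, ~~ par s} ->
  top_mon KW (r1 ++ r2) =
  tens (\prod_(s <- r1) sym_gen (x s)) (\prod_(s <- r2) sym_gen (y s)).
Proof.
move=> h1 h2; rewrite /top_mon big_cat /=.
have -> : \prod_(s <- r2) kod s = rt (\prod_(s <- r2) sym_gen (y s)).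
  elim: r2 h2 => [_|s r IH h]; first by rewrite !big_nil.
  rewrite !big_cons tens_1M -IH => [|t tr]; last by rewrite h // in_cons tr orbT.
  by rewrite /kod (negPf (h s _)) ?mem_head.
elim: r1 h1 => [_|s r IH h]; first by rewrite !big_nil mul1r.
rewrite !big_cons -tens_l -IH => [|t tr]; last by rewrite h // in_cons tr orbT.
by rewrite mulrA /kod (h s) ?mem_head.
Qed.

Lemma homog_koszul_top r : homog (odd (size r)) (top_mon KW r).
Proof.
rewrite /top_mon; elim: r => [|s r IH] /=; first by rewrite big_nil; exact: (@homog1 K).
by rewrite big_cons -addTb; apply: homogM => //; exact: homog_kod.
Qed.

End KoszulWeyl.

(** * The cohomology of the dual Koszul complex *)

Section KoszulExt.
Variables (A : superComRingType) (p q : nat).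
Hypothesis nat_inv : forall n, exists c : A, c *+ n.+1 = 1.

Local Notation V := (sfree A p q).
Local Notation W := (dual (Pi V)).
Local Notation I := ('I_p + 'I_q)%type.
Local Notation K := (koszul_dual A p q).

Local Notation spec f := (f A _ V W (@is_odd_index p q) (@svec A p q) (@dual_basis A p q)
  (@vform A p q) (@dform A p q) nat_inv (@vform_super A p q) (@dform_super A p q)
  (@homog_svec A p q) (@homog_dual_basis A p q) (@vform_svec A p q) (@dform_basis A p q)).

Definition ext_weyl := spec (@koszul_weyl).

(** The theta_j come before the d_chi_i, as in [top_elt]. *)
Definition ext_ord : seq I := map inr (index_enum 'I_q) ++ map inl (index_enum 'I_p).

Lemma ext_ord_uniq : uniq ext_ord.
Proof.
rewrite cat_uniq; apply/and3P; split.
- by rewrite map_inj_uniq ?index_enum_uniq // => ? ? [].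
- by apply/hasPn => _ /mapP[i _ ->]; apply/mapP => -[].
- by rewrite map_inj_uniq ?index_enum_uniq // => ? ? [].
Qed.

Lemma ext_ord_all s : s \in ext_ord.
Proof.
rewrite mem_cat; case: s => [i|j]; apply/orP; [right|left]; exact/map_f/mem_index_enum.
Qed.

Lemma ext_kelt : koszul_elt A p q = kelt ext_weyl.
Proof. by rewrite koszul_keltE big_sumType. Qed.

Lemma ext_top : top_elt A p q = top_mon ext_weyl ext_ord.
Proof.
rewrite koszul_top_monE.
- by rewrite !big_map.
- by move=> _ /mapP[j _ ->].
- by move=> _ /mapP[i _ ->].
Qed.

Lemma homog_top : homog (odd (p + q)) (top_elt A p q).
Proof.
rewrite ext_top; have := spec (@homog_koszul_top) ext_ord.
by rewrite size_cat !size_map -!sum1_size !big_const_ord !iter_addn_0 !mul1n addnC.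
Qed.

Lemma top_cocycle : cocycle p (top_elt A p q).
Proof.
split.
  apply: sums_of1; do 2! eexists; split; last reflexivity.
  apply: sums_of1; exists 1, [tuple dchi A q i | i < p].
  by rewrite scale1r big_tuple; apply: eq_bigr => i _; rewrite tnth_mktuple.
rewrite /delta ext_kelt ext_top; exact: (spec (@koszul_top_cocycle) ext_ord_uniq ext_ord_all).
Qed.

Lemma cocycle_top i z : cocycle i z ->
  exists a, (i <> p -> a = 0) /\ coboundary i (z - a *: top_elt A p q).
Proof.
case=> hz; rewrite /delta ext_kelt => dz.
have sp (v : V) : exists c, v = \sum_s c s *: svec A s.
  by exists (fun s => v s); exact: svec_expand.
have dsp (f : W) : exists c, f = \sum_s c s *: dual_basis A s.
  by exists (fun s => f (to_Pi (svec A s))); exact: dual_expand.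
have tz : tdeg i z := hz.
have [a [ha hc]] := spec (@koszul_cocycle) ext_ord_uniq ext_ord_all sp dsp tz dz.
exists a; split.
  (* The top degree counts the even indices, that is, the p vectors x_i. *)
  move=> ip; apply: ha; rewrite big_sumType /= sum1_card card_ord big1 // addn0 //.
rewrite ext_top; case: i hc {hz tz ha} => [|i] /=.
  by move=> ->; rewrite subrr.
by rewrite -ext_kelt.
Qed.

Lemma top_faithful i a : coboundary i (a *: top_elt A p q) -> a = 0.
Proof.
case: i => [|i [z _]]; rewrite /= /delta ext_top.
  exact: (spec (@koszul_top_free) ext_ord_uniq).
rewrite ext_kelt; exact: (spec (@koszul_top_faithful) ext_ord_uniq).
Qed.

Definition top_cycle : elements (cocycles A p q p) :=
  Element (asboolT top_cocycle : ssm_pred (cocycles A p q p) (top_elt A p q)).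

(** [cocycle_top] shows that the class generates, and [top_faithful] that no nonzero scalar kills
    it. *)
Lemma free_gen_Ext : free_gen (odd (p + q)) (Ext_class top_cycle).
Proof.
split.
- apply/homogP; rewrite -[LHS]cls_part; congr (cls _ _).
  by apply: val_inj; apply/homogP; exact: homog_top.
- move=> u; have [z ->] := cls_surj u; have [a [_ ha]] := cocycle_top (elementP z).
  by exists a; rewrite -[RHS]clsZ; apply/clsP.
- move=> a; rewrite -[LHS]clsZ -[0]cls0 => /clsP h.
  by apply: (@top_faithful p); move: h; rewrite subr0.
Qed.

Lemma Ext_trivial i : i <> p -> forall u : Ext A p q i, u = 0.
Proof.
move=> ip u; have [z ->] := cls_surj u.
have [a [ha hb]] := cocycle_top (elementP z).
by rewrite -cls0; apply/clsP; move: hb; rewrite ha // scale0r; rewrite /= !subr0.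
Qed.

End KoszulExt.

Theorem theorem4p3 (k : fieldType) (char0 : [pchar k] =i pred0)
    (A : superComRingType) (iota : {rmorphism k -> A})
    (iota_even : forall c : k, homog false (iota c)) (p q : nat) :
  (forall i : nat,
     super_iso (Ext A p q i)
       (if i == p then iterPi (p + q) A^o else sfree A 0 0 : superLmodType A)) /\
  (exists z : elements (cocycles A p q p),
     val z = top_elt A p q /\
     forall e : Ext A p q p, exists a : A, e = a *: Ext_class z).
Proof.
have nat_inv n : exists c : A, c *+ n.+1 = 1.
  (* The inverse of n + 1 exists in [k] by characteristic 0 and is carried to [A] by [iota]. *)
  exists (iota (n.+1%:R^-1)); rewrite -rmorphMn -mulr_natl divff ?rmorph1 //.
  by rewrite ((pcharf0P k).1 char0).
have top_gen := free_gen_Ext p q nat_inv.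
split=> [i|]; last first.
  by exists (top_cycle p q nat_inv); split=> //; case: top_gen.
case: eqP => [->|ip].
  (* Both sides are free on one generator of parity p + q. *)
  by have [u hu] := free_gen_iterPi A (p + q); exact: free_gen_iso top_gen hu.
(* Both modules are zero, [sfree A 0 0] having an empty basis. *)
exists (\0 : {linear Ext A p q i -> sfree A 0 0}); split=> [|b x _]; last exact: homog0.
exists (fun=> 0) => x; first exact: esym (Ext_trivial nat_inv ip x).
by apply/ffunP => -[[]|[]].
Qed.
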